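(* Let $(M,I(M))$ be a pi-space. (1) If $I(M)$ is finite-dimensional, then $I(M)$ is a homotopically Cohen–Macaulay simplicial complex. (2) If $I(M)$ is infinite-dimensional, then $I(M)$ is a contractible poset.
   Context: A pre-independence space (pi-space) is a pair $(M,I(M))$ where $M$ is a non-empty set and $I(M)$ is a non-empty family of subsets of $M$ (the independent sets) such that (I1) every subset of a member of $I(M)$ lies in $I(M)$, and (I2) if $\sigma,\tau\in I(M)$ are finite with $|\sigma|>|\tau|$, then there is $x\in\sigma\setminus\tau$ with $\tau\cup\{x\}\in I(M)$. $I(M)$ is regarded as a poset ordered by inclusion; its topology and dimension are those of the order complex of $I(M)\setminus\{\emptyset\}$ (when all independent sets are finite, this is the barycentric subdivision of the simplicial complex $I(M)$). A finite-dimensional simplicial complex $K$ is spherical if it is $(\dim K-1)$-connected, and (homotopically) Cohen–Macaulay if for every simplex $\sigma$ of $K$ (including the empty one) the link $\mathrm{Lk}_K(\sigma)$ is spherical of dimension $\dim K-|\sigma|$. *)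

(* Defs.v *)
From HB Require Import structures.
From mathcomp Require Import all_boot all_order all_algebra finmap.
From mathcomp Require Import all_classical all_reals.
From mathcomp Require Import topology normedtype.

Set Implicit Arguments.
Unset Strict Implicit.
Unset Printing Implicit Defensive.

Import Order.TTheory GRing.Theory Num.Theory.
Import numFieldNormedType.Exports.

Local Open Scope classical_set_scope.
Local Open Scope ring_scope.

(* The ground set is the carrier type; [I] is the family of independent sets,
   which may contain infinite sets. *)
Record pi_space (M : choiceType) (I : set (set M)) : Prop := PiSpace {
  pi_ground_nonempty : [set: M] !=set0;
  pi_nonempty : I !=set0;
  pi_subset : forall s t : set M, t `<=` s -> I s -> I t;
  pi_exchange : forall s t : set M, I s -> I t ->
    finite_set s -> finite_set t ->
    (#|` fset_set t| < #|` fset_set s|)%N ->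
    exists2 x, (s `\` t) x & I (x |` t)
}.

(* Complexes are families of subsets of a vertex type [V], with the empty
   simplex included; elements of [V] that lie in no simplex are not vertices. *)
Record simplicial_complex (V : choiceType) (K : set (set V)) : Prop :=
  SimplicialComplex {
  sc_empty : K set0;
  sc_finite : forall s, K s -> finite_set s;
  sc_subset : forall s t : set V, t `<=` s -> K s -> K t
}.

Definition link (V : choiceType) (K : set (set V)) (s : set V) : set (set V) :=
  [set t | s `&` t = set0 /\ K (s `|` t)].

(* For finite simplices only; the complex reduced to the empty simplex has
   dimension -1. *)
Definition has_dim (V : choiceType) (K : set (set V)) (d : int) : Prop :=
  (exists2 s, K s & #|` fset_set s|%:Z = d + 1) /\
  (forall s, K s -> #|` fset_set s|%:Z <= d + 1).

Definition finite_dimensional (V : choiceType) (K : set (set V)) : Prop :=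
  exists n : nat, forall s, K s -> (#|` fset_set s| <= n)%N.

Definition order_complex (M : choiceType) (P : set (set M)) :
    set (set (set M)) :=
  [set c | [/\ finite_set c, c `<=` P &
    forall A B, c A -> c B -> A `<=` B \/ B `<=` A]].

(* Points of the geometric realization, in barycentric coordinates.  The finitely
   supported sum is 0 when the support is infinite, so every point has a finite
   nonempty support. *)
Record realization (R : realType) (V : choiceType) (K : set (set V)) : Type :=
  Realization {
  bary : V -> R;
  bary_ge0 : forall v, 0 <= bary v;
  bary_supp : K [set v | bary v != 0];
  bary_sum : \sum_(v \in [set: V]) bary v = 1
}.

Section weak_topology.
Variables (R : realType) (V : choiceType) (K : set (set V)).
Local Notation X := (realization R K).

HB.instance Definition _ := gen_eqMixin X.
HB.instance Definition _ := gen_choiceMixin X.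

Definition closed_simplex (s : set V) : set X :=
  [set x | [set v | bary x v != 0] `<=` s].

(* Weak (coherent) topology: the trace on each closed simplex is open for the
   Euclidean topology of that simplex, i.e. the one induced by [R^V]. *)
Definition realization_open (U : set X) : Prop :=
  forall s, K s -> exists2 O : set (V -> R),
    open (O : set {ptws V -> R}) &
    U `&` closed_simplex s = (@bary R V K @^-1` O) `&` closed_simplex s.

Lemma realization_openT : realization_open setT.
Proof. by move=> s _; exists setT => //; exact: openT. Qed.

Lemma realization_openI : setI_closed realization_open.
Proof.
move=> A B oA oB s Ks; have [O1 o1 e1] := oA s Ks; have [O2 o2 e2] := oB s Ks.
exists (O1 `&` O2); first exact: openI.
by rewrite preimage_setI setIIl e1 e2 -setIIl.
Qed.

Lemma realization_open_bigU (J : Type) (f : J -> set X) :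
  (forall j, realization_open (f j)) -> realization_open (\bigcup_j f j).
Proof.
move=> of_ s Ks.
have /choice[O OP] : forall j, exists O : set (V -> R),
    open (O : set {ptws V -> R}) /\
    f j `&` closed_simplex s = (@bary R V K @^-1` O) `&` closed_simplex s.
  by move=> j; have [O] := of_ j s Ks; exists O.
exists (\bigcup_j O j); first by apply: bigcup_open => j _; case: (OP j).
rewrite preimage_bigcup !setI_bigcupl.
by apply: eq_bigcupr => j _; case: (OP j).
Qed.

HB.instance Definition _ := isOpenTopological.Build X
  realization_openT realization_openI realization_open_bigU.

Lemma realization_openE (U : set X) : open U = realization_open U.
Proof. by []. Qed.

End weak_topology.

Definition unit_sphere (R : realType) (n : nat) : set 'rV[R]_n :=
  [set x | \sum_(i < n) x ord0 i ^+ 2 = 1].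

Definition unit_ball (R : realType) (n : nat) : set 'rV[R]_n :=
  [set x | \sum_(i < n) x ord0 i ^+ 2 <= 1].

(* Nothing is required for [n < -1], and (-1)-connected means nonempty.  The
   k-sphere lives in dimension k+1; only the values of [f] on the sphere and of
   [g] on the ball matter. *)
Definition n_connected (R : realType) (X : topologicalType) (n : int) : Prop :=
  (-1 <= n -> [set: X] !=set0) /\
  (forall k : nat, k%:Z <= n ->
    forall f : 'rV[R]_k.+1 -> X,
      {within @unit_sphere R k.+1, continuous f} ->
      exists2 g : 'rV[R]_k.+1 -> X,
        {within @unit_ball R k.+1, continuous g} &
        forall x, unit_sphere x -> g x = f x).

Definition contractible (R : realType) (X : topologicalType) : Prop :=
  exists (x0 : X) (H : X * R -> X),
    [/\ {within [set: X] `*` `[0, 1], continuous H},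
        forall x, H (x, 0) = x &
        forall x, H (x, 1) = x0].

Definition spherical (R : realType) (V : choiceType) (K : set (set V))
    (d : int) : Prop :=
  has_dim K d /\ n_connected R (realization R K) (d - 1).

Definition cohen_macaulay (R : realType) (V : choiceType) (K : set (set V)) :
    Prop :=
  exists2 d : int, has_dim K d &
    forall s, K s -> spherical R (link K s) (d - #|` fset_set s|%:Z).

(* Main.v *)
(* Points of the realization of a complex on M are functions on M.  Fix an
   independent sequence b_0, b_1, ... (a basis in rank r, an infinite sequence in
   infinite rank).  For a finite independent set s smaller than this sequence,
   let xi s be the first b_j outside the closure of s and b_0, .., b_(j-1).
   Being outside a closure is antitone, so for any independent A the points xi s,
   with s ranging over supersets of A, are jointly independent over A.

   For a function w with independent support of size less than r, cut w at a
   threshold s and replace its part below s, level by level, by masses at the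
   points xi {w > t}, t < s.  At every time the support is {w > s} together with
   points xi s' for s' containing {w > s}, hence independent, and at the end the
   whole mass lies on the sequence.  This contracts the codimension one skeleton
   inside the complex by an explicit formula.

   In finite rank r, a map f from the k-sphere with k <= r - 2 is pushed into
   that skeleton inside its carrier by Kuhn's triangulation of a fine grid on the
   sup-norm sphere: every point meets at most k + 1 stars.  Links are again
   pi-spaces.  In infinite rank, a point sum_i p_i A_i of the order complex is
   the function sum_i p_i 1_(A_i) on M, and its chain is recovered from the level
   sets; it moves straight to sum_i p_i delta_(y A_i), with y A in A, which has
   finite support, and from there the contraction above applies. *)

Require Import Defs.
From mathcomp Require Import all_boot all_order all_algebra finmap.
From mathcomp Require Import all_classical all_reals.
From mathcomp Require Import topology normedtype realfun.
From mathcomp Require Import zify lra.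

Set Implicit Arguments.
Unset Strict Implicit.
Unset Printing Implicit Defensive.

Import Order.TTheory GRing.Theory Num.Theory.
Import numFieldNormedType.Exports.

Local Open Scope classical_set_scope.
Local Open Scope ring_scope.

(** * Independent selectors *)

Lemma pi_exchange_fset (M : choiceType) (I : set (set M)) (piI : pi_space I)
    (s t : {fset M}) :
  I [set` s] -> I [set` t] -> (#|` t| < #|` s|)%N ->
  exists2 x, (x \in s) && (x \notin t) & I [set` (x |` t)%fset].
Proof.
move=> Is It lts.
have := pi_exchange piI Is It (finite_fset s) (finite_fset t).
rewrite !set_fsetK => /(_ lts)[x [/= xs xt] Ixt].
exists x; first by rewrite xs; exact/negP.
by rewrite set_fsetU1.
Qed.

(** Exchange is repeated until the sizes agree. Staying inside the union of [t] and [s] keeps the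
    extension within any set that contains both. *)
Lemma pi_extend (M : choiceType) (I : set (set M)) (piI : pi_space I)
    (s t : {fset M}) :
  I [set` s] -> I [set` t] -> (#|` t| <= #|` s|)%N ->
  exists u : {fset M}, [/\ (t `<=` u)%fset, (u `<=` t `|` s)%fset,
    #|` u| = #|` s| & I [set` u]].
Proof.
move=> Is; move en : (#|` s| - #|` t|)%N => n.
elim: n t en => [|n IHn] t en It le_ts.
  by exists t; split => //; [exact: fsubsetUl|lia].
have [|x /andP[xs xt] Ix] := pi_exchange_fset piI Is It; first lia.
have cx : #|` (x |` t)%fset| = #|` t|.+1 by rewrite cardfsU1 xt.
have [| |//|u [tu us cu Iu]] := IHn (x |` t)%fset; [lia|by []|lia|].
exists u; split => //.
  by apply: fsubset_trans tu; exact: fsubsetU1.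
apply: (fsubset_trans us); rewrite fsubUset fsubsetUr andbT fsubUset fsub1set.
by rewrite in_fsetU xs orbT fsubsetUl.
Qed.

Section free_elements.
Variables (M : choiceType) (I : set (set M)).
Hypothesis piI : pi_space I.

(* For finite [S]: [x] lies outside the matroid closure of [S].  This form is
   visibly antitone in [S]. *)
Definition free_over (S : set M) (x : M) : Prop :=
  ~ S x /\ forall J : {fset M}, [set` J] `<=` S -> I [set` J] ->
    I [set` (x |` J)%fset].

Lemma free_over_subset (S T : set M) x : S `<=` T -> free_over T x ->
  free_over S x.
Proof.
move=> ST [Tx free]; split=> [/ST//|J JS]; apply: free.
exact: subset_trans ST.
Qed.

(** A set [J] that becomes dependent with [x] extends inside [S] to the size of [s]. A larger [t]
    would exchange an element into this extension: if it is [x], then [J] with [x] would be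
    independent; if it lies in [S], the rank of [S] is exceeded. *)
Lemma not_free_over_rank (s : {fset M}) (S : set M) x :
  I [set` s] -> [set` s] `<=` S ->
  (forall t : {fset M}, [set` t] `<=` S -> I [set` t] -> (#|` t| <= #|` s|)%N) ->
  ~ free_over S x ->
  forall t : {fset M}, [set` t] `<=` x |` S -> I [set` t] ->
    (#|` t| <= #|` s|)%N.
Proof.
move=> Is sS rkS nfree t tS It; rewrite leqNgt; apply/negP => lts.
have Sx : ~ S x.
  move=> Sx; suff /rkS/(_ It) : [set` t] `<=` S by lia.
  by move=> y /tS[->|].
have {nfree}[J [JS IJ nIxJ]] : exists J : {fset M},
    [/\ [set` J] `<=` S, I [set` J] & ~ I [set` (x |` J)%fset]].
  apply: contra_notP nfree => H; split=> // J JS IJ.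
  by apply: contra_notP H => nI; exists J.
have [J' [JJ' J'S cJ' IJ']] := pi_extend piI Is IJ (rkS _ JS IJ).
have {}J'S : [set` J'] `<=` S.
  by move=> y /= /(fsubsetP J'S); rewrite in_fsetU => /orP[/JS|/sS].
have [|y /andP[yt yJ'] IyJ'] := pi_exchange_fset piI It IJ'; first lia.
have [yx|/eqP yx] := eqVneq y x.
  apply: nIxJ; apply: (pi_subset piI _ IyJ') => z /=.
  rewrite !inE yx => /orP[->//|/(fsubsetP JJ') ->]; exact: orbT.
suff /rkS/(_ IyJ') : [set` (y |` J')%fset] `<=` S.
  by rewrite cardfsU1 yJ' cJ'; lia.
move=> z /=; rewrite !inE => /orP[/eqP->|/J'S//].
by have /= [] := tS _ yt.
Qed.

(** If no [e j] were free, adding the terms one by one would never raise the rank above the size of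
    [s], but [b] is larger. *)
Lemma free_over_exists (e : nat -> M) (n : nat) (s b : {fset M}) :
  I [set` s] -> I [set` b] -> (#|` s| < #|` b|)%N ->
  [set` b] `<=` e @` `I_n ->
  exists2 j, (j < n)%N & free_over ([set` s] `|` e @` `I_j) (e j).
Proof.
move=> Is Ib lt_sb be; apply: contrapT => nex.
have rk j : (j <= n)%N -> forall t : {fset M},
    [set` t] `<=` [set` s] `|` e @` `I_j -> I [set` t] -> (#|` t| <= #|` s|)%N.
  elim: j => [|j IHj] jn t.
    rewrite II0 image_set0 setU0 => ts _; apply: fsubset_leq_card.
    by apply/fsubsetP => y /ts.
  move=> tS It.
  have nf : ~ free_over ([set` s] `|` e @` `I_j) (e j).
    by move=> f; apply: nex; exists j.
  apply: (@not_free_over_rank s ([set` s] `|` e @` `I_j) (e j)) => //.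
    by apply: IHj; exact: ltnW.
  move=> y /tS[ys|[i /= ij <-]]; first by right; left.
  have [->|nij] := eqVneq i j; first by left.
  by right; right; exists i => //=; lia.
suff : (#|` b| <= #|` s|)%N by lia.
by apply: (rk n) => // y /be; right.
Qed.

(* The witness [xi s] is taken from a fixed independent sequence; since freeness
   is antitone, the witnesses of all supersets of [A] are jointly independent
   over [A]. *)
Lemma selector_exists (small : set (set M)) (e : nat -> M) :
  (forall s : {fset M}, I [set` s] -> small [set` s] -> exists n (b : {fset M}),
    [/\ (#|` s| < #|` b|)%N, I [set` b] & [set` b] `<=` e @` `I_n]) ->
  exists xi : set M -> M, forall (A : set M) (C : set (set M)),
    finite_set A -> I A -> finite_set C ->
    (forall s, C s -> [/\ A `<=` s, finite_set s, I s & small s]) ->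
    I (A `|` xi @` C).
Proof.
move=> eP.
pose P (s : set M) j := free_over (s `|` e @` `I_j) (e j).
have /choice[j jP] : forall s : set M, exists j : nat,
    finite_set s -> I s -> small s -> P s j.
  move=> s; have [fs|nfs] := pselect (finite_set s); last by exists 0%N.
  have [Is|] := pselect (I s); last by exists 0%N.
  have [sms|] := pselect (small s); last by exists 0%N.
  have := eP (fset_set s); rewrite fset_setK // => /(_ Is sms)[n [b [sb Ib be]]].
  have := @free_over_exists e n (fset_set s) b; rewrite fset_setK //.
  by move=> /(_ Is Ib sb be)[i _ Pi]; exists i.
exists (e \o j) => A C fA IA fC CP.
(* [E n] adds to [A] the terms before [n] that are free over [A] and their predecessors. It stays
   independent by induction, since freeness of [e n] can be tested on [E n] itself. For large [n] it
   contains every witness [xi s], which is free even over the larger set [s]. *)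
pose E n := A `|` e @` [set i | (i < n)%N /\ P A i].
have finE n : finite_set (E n).
  rewrite finite_setU; split => //; apply: finite_image.
  by apply: (sub_finite_set _ (finite_II n)) => i [].
have IE n : I (E n).
  elim: n => [|n IHn].
    by apply: (pi_subset piI _ IA) => y [//|[i []]].
  have [PAn|nP] := pselect (P A n); last first.
    apply: (pi_subset piI _ IHn) => y [Ay|[i [/= lti Pi] <-]]; first by left.
    right; exists i => //; split=> //.
    by have [ein|] := eqVneq i n; [rewrite ein in Pi|lia].
  have [_ /(_ (fset_set (E n)))] := PAn.
  rewrite set_fsetU1 fset_setK // => /(_ _ IHn) H.
  apply: (pi_subset piI _ (H _)).
    move=> y [Ay|[i [/= lti Pi] <-]]; first by right; left.
    have [->|ni] := eqVneq i n; first by left.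
    by right; right; exists i => //; split=> //; lia.
  move=> y [Ay|[i [/= lti Pi] <-]]; first by left.
  by right; exists i.
have [r rE] := (finite_seqP _).1 fC.
pose n := (\max_(s <- r) j s).+1.
apply: (pi_subset piI _ (IE n)) => y [Ay|[s Cs <-]]; first by left.
right; exists (j s) => //=; split.
  by rewrite /n ltnS; apply: leq_bigmax_seq => //; have : [set` r] s by rewrite -rE.
have [As fs Is sms] := CP s Cs.
apply: free_over_subset (jP s fs Is sms).
by apply: setSU.
Qed.

End free_elements.

(** * Level sets and chain coordinates *)

Section level_weights.
Variables (R : realType) (M : choiceType).
Implicit Types (v w : M -> R) (A B : set M).

(* The length of the interval of thresholds [t >= 0] with [{v > t} = A]: the
   barycentric coordinate of [A] when [v] is written as a positive combination
   of indicators of a chain of sets.  If [A] is everything, the supremum is the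
   junk value [sup set0 = 0], as it should. *)
Definition level v A : R := Num.max 0 (inf (v @` A) - sup (v @` (~` A))).

(** For finite [T] this makes [v] a step function, so that its extrema over nonempty sets are
    attained even when these are infinite. *)
Definition factors (T : Type) (p : M -> T) v :=
  forall x y, p x = p y -> v x = v y.

Lemma level_ge0 v A : 0 <= level v A.
Proof. by rewrite /level le_max lexx. Qed.

Lemma inf_image_min v A x : A x -> (forall y, A y -> v x <= v y) ->
  inf (v @` A) = v x.
Proof.
move=> Ax minx; apply/eqP; rewrite eq_le; apply/andP; split.
  apply: ge_inf; last by exists x.
  by exists (v x) => _ [y Ay <-]; exact: minx.
by apply: lb_le_inf; [exists (v x), x|move=> _ [y Ay <-]; exact: minx].
Qed.

Lemma sup_image_max v A x : A x -> (forall y, A y -> v y <= v x) ->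
  sup (v @` A) = v x.
Proof.
move=> Ax maxx; apply/eqP; rewrite eq_le; apply/andP; split.
  by apply: ge_sup; [exists (v x), x|move=> _ [y Ay <-]; exact: maxx].
apply: ub_le_sup; last by exists x.
by exists (v x) => _ [y Ay <-]; exact: maxx.
Qed.

Section finite_factor.
Variables (T : finType) (p : M -> T).

Lemma factors_min v A : factors p v -> A !=set0 ->
  exists2 x, A x & forall y, A y -> v x <= v y.
Proof.
move=> pv [a Aa].
have /choice[r rP] : forall t, exists x, (p @` A) t -> A x /\ p x = t.
  move=> t; have [[x Ax <-]|nt] := pselect ((p @` A) t); first by exists x.
  by exists a => /nt.
have pa : `[< (p @` A) (p a) >] by apply/asboolP; exists a.
case: (@arg_minP _ R T (p a) (fun t => `[< (p @` A) t >]) (fun t => v (r t)) pa).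
move=> t /asboolP tA tmin; exists (r t); first by have [] := rP _ tA.
move=> y Ay; have yA : (p @` A) (p y) by exists y.
apply: le_trans (tmin (p y) _) _; first exact/asboolP.
by rewrite (pv (r (p y)) y) //; have [] := rP _ yA.
Qed.

Lemma factors_max v A : factors p v -> A !=set0 ->
  exists2 x, A x & forall y, A y -> v y <= v x.
Proof.
move=> pv A0; have [|x Ax xmin] := @factors_min (fun x => - v x) A _ A0.
  by move=> x y /pv ->.
by exists x => // y /xmin; rewrite lerN2.
Qed.

(** Extrema are attained, so a positive gap separates the values on [A] from those outside.
    Nonnegativity of [v] excludes the empty set, where [inf set0] is 0. *)
Lemma level_gt0 v A : factors p v -> (forall x, 0 <= v x) -> 0 < level v A ->
  [/\ A !=set0, forall x, A x -> 0 < v x &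
    forall x y, A x -> ~ A y -> v y < v x].
Proof.
move=> pv v0; rewrite /level lt_max ltxx /= subr_gt0 => lt_si.
have [A0|] := pselect (A !=set0); last first.
  move=> /set0P/negP/negPn/eqP A0; move: lt_si; rewrite A0 image_set0 inf0 setC0.
  move=> supneg; exfalso.
  have [M0|] := pselect ([set: M] !=set0).
    have [x _ xmax] := factors_max pv M0.
    by move: supneg; rewrite (@sup_image_max _ _ x) // ltNge v0.
  move=> /set0P/negP/negPn/eqP M0; move: supneg.
  by rewrite M0 image_set0 sup0 ltxx.
have [a Aa amin] := factors_min pv A0.
rewrite (inf_image_min Aa amin) in lt_si.
have [cA0|] := pselect ((~` A) !=set0); last first.
  move=> /set0P/negP/negPn/eqP cA0; move: lt_si.
  rewrite cA0 image_set0 sup0 => va; split => //.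
    by move=> x Ax; exact: lt_le_trans (amin x Ax).
  by move=> x y _ nAy; have : (~` A) y by []; rewrite cA0.
have [b nAb bmax] := factors_max pv cA0.
rewrite (sup_image_max nAb bmax) in lt_si.
split => // [x Ax|x y Ax nAy].
  exact: le_lt_trans (v0 b) (lt_le_trans lt_si (amin x Ax)).
exact: le_lt_trans (bmax y nAy) (lt_le_trans lt_si (amin x Ax)).
Qed.

(** A superlevel set of [v] is a union of fibres of [p]. Hence the sets of positive level come from
    a finite family that depends on [p] alone. *)
Lemma level_saturated v A : factors p v -> (forall x, 0 <= v x) ->
  0 < level v A -> A = p @^-1` [set` [set t | t \in p @` A]%SET].
Proof.
move=> pv v0 /level_gt0[//|//|_ _ ltA]; apply/seteqP; split => x.
  by move=> Ax /=; rewrite inE; apply/mem_set; exists x.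
rewrite /= inE => /set_mem[y Ay yx]; apply: contrapT => /(ltA y x Ay).
by rewrite (pv y x yx) ltxx.
Qed.

Lemma finite_saturated : finite_set [set p @^-1` [set` S] | S in [set: {set T}]].
Proof. exact/finite_image/finite_finset. Qed.

Lemma level_gt0_saturated v A : factors p v -> (forall x, 0 <= v x) ->
  0 < level v A -> [set p @^-1` [set` S] | S in [set: {set T}]] A.
Proof.
move=> pv v0 l0; rewrite (level_saturated pv v0 l0).
by exists [set t | t \in p @` A]%SET.
Qed.

Lemma finite_level v : factors p v -> (forall x, 0 <= v x) ->
  finite_set [set A | level v A != 0].
Proof.
move=> pv v0; apply: sub_finite_set finite_saturated => A /= lA.
by apply: (level_gt0_saturated pv v0); rewrite lt_neqAle eq_sym lA level_ge0.
Qed.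

Lemma level_chain v A B : factors p v -> (forall x, 0 <= v x) ->
  0 < level v A -> 0 < level v B -> A `<=` B \/ B `<=` A.
Proof.
move=> pv v0 /level_gt0[//|//|_ _ ltA] /level_gt0[//|//|_ _ ltB].
apply: contrapT => /not_orP[/existsNP[x /not_implyP[Ax nBx]]].
move=> /existsNP[y /not_implyP[By nAy]].
by have := lt_trans (ltA x y Ax nAy) (ltB y x By nBx); rewrite ltxx.
Qed.

(** The set where [v] is maximal works: its level is the gap to the next value, or to 0 if [v] is
    constant. *)
Lemma level_gt0_exists v x : factors p v -> (forall y, 0 <= v y) -> 0 < v x ->
  exists A, 0 < level v A.
Proof.
move=> pv v0 vx; have [|a _ amax] := factors_max pv (_ : [set: M] !=set0).
  by exists x.
pose A := [set y | v y = v a].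
exists A; rewrite /level lt_max ltxx /= subr_gt0.
rewrite (@inf_image_min _ _ a) //; last by move=> y ->.
have [cA0|] := pselect ((~` A) !=set0); last first.
  move=> /set0P/negP/negPn/eqP ->; rewrite image_set0 sup0.
  exact: lt_le_trans vx (amax _ _).
have [b nAb bmax] := factors_max pv cA0.
by rewrite (sup_image_max nAb bmax) lt_neqAle amax // andbT; exact/eqP.
Qed.

(** With a fixed finite partition, pointwise continuity is uniform on [M], and [inf] and [sup] are
    1-Lipschitz for the uniform distance. *)
Lemma level_continuous (Z : topologicalType) (v : Z -> M -> R) A :
  (forall z, factors p (v z)) -> (forall z x, 0 <= v z x) ->
  (forall x, continuous (fun z => v z x)) -> continuous (fun z => level (v z) A).
Proof.
move=> pv v0 cv z0; rewrite /level.
have near_unif (e : R) : 0 < e ->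
    \forall z \near z0, forall x, `|v z0 x - v z x| <= e.
  move=> e0.
  have : \forall z \near z0, forall t : T, forall x, p x = t ->
      `|v z0 x - v z x| <= e.
    apply: filter_forall => t; have [[x px]|nt] := pselect (exists x, p x = t).
      have /cvgrPdist_le/(_ e e0) := cv x z0; apply: filterS => z lez y py.
      by rewrite (pv z0 y x) ?(pv z y x) // px.
    by apply: nearW => z x px; exfalso; apply: nt; exists x.
  by apply: filterS => z Hz x; exact: Hz.
have lip_inf (z1 z2 : Z) e : 0 < e -> (forall x, `|v z1 x - v z2 x| <= e) ->
    inf (v z1 @` A) <= inf (v z2 @` A) + e.
  move=> e0 le_e; have [->|/set0P A0] := eqVneq A set0.
    by rewrite !image_set0 inf0 add0r ltW.
  have [a Aa amin] := factors_min (pv z1) A0.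
  have [b Ab bmin] := factors_min (pv z2) A0.
  rewrite (inf_image_min Aa amin) (inf_image_min Ab bmin).
  by have := amin b Ab; have := le_e b; rewrite ler_norml => /andP[]; lra.
have lip_sup (z1 z2 : Z) e : 0 < e -> (forall x, `|v z1 x - v z2 x| <= e) ->
    sup (v z1 @` (~` A)) <= sup (v z2 @` (~` A)) + e.
  move=> e0 le_e; have [->|/set0P A0] := eqVneq (~` A) set0.
    by rewrite !image_set0 sup0 add0r ltW.
  have [a Aa amax] := factors_max (pv z1) A0.
  have [b Ab bmax] := factors_max (pv z2) A0.
  rewrite (sup_image_max Aa amax) (sup_image_max Ab bmax).
  by have := bmax a Aa; have := le_e a; rewrite ler_norml => /andP[]; lra.
apply/cvgrPdist_le => e e0; have e20 : 0 < e / 2 by lra.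
have := near_unif _ e20; apply: filterS => z le_e.
have le_e' x : `|v z x - v z0 x| <= e / 2 by rewrite distrC.
have := lip_inf z0 z _ e20 le_e; have := lip_inf z z0 _ e20 le_e'.
have := lip_sup z0 z _ e20 le_e; have := lip_sup z z0 _ e20 le_e'.
set i0 := inf _; set i1 := inf _; set s0 := sup _; set s1 := sup _.
move=> h1 h2 h3 h4; rewrite ler_norml.
by rewrite /Num.max; do 2 case: ifPn; rewrite -?leNgt => *; apply/andP; split; lra.
Qed.

End finite_factor.
End level_weights.

(** * The deformation *)

Section deformation.
Variables (R : realType) (M : choiceType).
Implicit Types (u w : M -> R) (xi : set M -> M).

(** The image under [xi] of the measure that gives each set [A] the mass [level w A]. *)
Definition push xi w x : R := \sum_(A \in [set A | xi A = x]) level w A.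

Section push_theory.
Variables (T : finType) (p : M -> T) (xi : set M -> M) (w : M -> R).
Hypotheses (pw : factors p w) (w0 : forall x, 0 <= w x).

(** The range of summation no longer depends on [w], so continuity in [w] can be checked term by
    term. *)
Lemma push_sum x : push xi w x =
  \sum_(A <- fset_set [set p @^-1` [set` S] | S in [set: {set T}]])
     if `[< xi A = x >] then level w A else 0.
Proof.
rewrite -[RHS]big_mkcond -[RHS]big_filter /push.
rewrite (fsbigE [seq A <- fset_set [set p @^-1` [set` S] | S in [set: {set T}]] |
   `[< xi A = x >]]).
- rewrite [RHS]big_seq_cond [LHS]big_seq_cond; apply: eq_bigl => A.
  rewrite andbT andb_idr // mem_filter => /andP[/asboolP xA _].
  by apply/mem_set.
- exact/filter_uniq/fset_uniq.
- by move=> A /=; rewrite mem_filter => /andP[/asboolP].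
- move=> A /= xA; rewrite mem_filter negb_and => /orP[/asboolP//|].
  rewrite in_fset_set; last exact: finite_saturated.
  move=> nA; apply/eqP; rewrite eq_le level_ge0 andbT leNgt.
  by apply/negP => /(level_gt0_saturated pw w0) /mem_set; exact/negP.
Qed.

Lemma push_ge0 x : 0 <= push xi w x.
Proof. by apply: fsumr_ge0 => A _; exact: level_ge0. Qed.

Lemma push_neq0 x : push xi w x != 0 -> exists2 A, xi A = x & 0 < level w A.
Proof.
move=> px; have : 0 < push xi w x by rewrite lt_neqAle eq_sym px push_ge0.
by move/(fsumr_gt0 [::]) => [A xA lA]; exists A.
Qed.

Lemma push_gt0 A : 0 < level w A -> 0 < push xi w (xi A).
Proof.
move=> lA; rewrite push_sum (big_rem A) /=; last first.
  rewrite in_fset_set; last exact: finite_saturated.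
  exact/mem_set/(level_gt0_saturated pw w0).
rewrite asboolT // ltr_pwDl //; apply: sumr_ge0 => B _.
by case: ifP => // _; exact: level_ge0.
Qed.

End push_theory.

Lemma push0 xi x : push xi (fun=> 0) x = 0.
Proof.
apply: fsbig1 => A _; rewrite /level.
have im0 (B : set M) (f : set R -> R) : f set0 = 0 -> f [set 0] = 0 ->
    f [set 0 | _ in B] = 0.
  move=> f0 f1; have [->|/set0P B0] := eqVneq B set0; first by rewrite image_set0.
  suff -> : [set (0 : R) | _ in B] = [set 0] by [].
  by case: B0 => b Bb; apply/seteqP; split=> [_ [y _ <-]//|_ ->]; exists b.
by rewrite !im0 ?inf0 ?sup0 ?inf1 ?sup1 // subrr maxxx.
Qed.

Definition clamp (a : R) : R := Num.min 1 (Num.max 0 a).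

Lemma clamp_ge0 a : 0 <= clamp a.
Proof. by rewrite /clamp le_min ler01 le_max lexx. Qed.

Lemma clamp_le1 a : clamp a <= 1.
Proof. by rewrite /clamp ge_min lexx. Qed.

Lemma clamp_0 a : a <= 0 -> clamp a = 0.
Proof. by move=> a0; rewrite /clamp (max_idPl _) // min_r. Qed.

Lemma clamp_1 a : 1 <= a -> clamp a = 1.
Proof. by move=> a1; rewrite /clamp (max_idPr _) ?min_l //; lra. Qed.

Lemma clamp_gt0 a : 0 < a -> 0 < clamp a.
Proof. by move=> a0; rewrite /clamp lt_min ltr01 lt_max a0 orbT. Qed.

(* Three successive moves, for [t] in [[0, 1]], [[1, 2]] and [[2, 3]]: from [u]
   straight to [w]; then, raising a threshold [s] from 0 to 1, the part of [w]
   below [s] is replaced level by level by Dirac masses at the points [xi {w > r}],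
   [r < s]; finally straight to the Dirac mass at [xi set0].  In the second move
   the support is [{w > s}] together with points [xi B] for [B] containing
   [{w > s}]. *)
Definition deform xi u w (t : R) (x : M) : R :=
  (1 - clamp t) * u x + clamp t *
   ((1 - clamp (t - 2)) * (Num.max 0 (w x - clamp (t - 1)) +
       push xi (fun y => Num.min (clamp (t - 1)) (w y)) x) +
    clamp (t - 2) * (x == xi set0)%:R).

Lemma deform_ge0 xi u w t x : (forall x, 0 <= u x) -> 0 <= deform xi u w t x.
Proof.
move=> u0; rewrite /deform.
have := clamp_ge0 t; have := clamp_le1 t.
have := clamp_ge0 (t - 2); have := clamp_le1 (t - 2).
move=> *; rewrite addr_ge0 // mulr_ge0 ?subr_ge0 // addr_ge0 // mulr_ge0 ?subr_ge0 //.
by rewrite addr_ge0 ?push_ge0 // le_max lexx.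
Qed.

Lemma deform_le1 xi u w t : t <= 1 -> (forall x, 0 <= w x) ->
  deform xi u w t = fun x => (1 - clamp t) * u x + clamp t * w x.
Proof.
move=> t1 w0; apply/funext => x; rewrite /deform.
rewrite (clamp_0 (_ : t - 2 <= 0)) ?(clamp_0 (_ : t - 1 <= 0)); try lra.
rewrite !subr0 mul1r mul0r addr0 (max_idPr (w0 x)).
suff -> : (fun y => Num.min 0 (w y)) = fun=> 0 by rewrite push0 addr0.
by apply/funext => y; rewrite min_l.
Qed.

Lemma deform_le0 xi u w t : t <= 0 -> (forall x, 0 <= w x) ->
  deform xi u w t = u.
Proof.
move=> t0 w0; rewrite deform_le1 //; last lra.
by apply/funext => x; rewrite clamp_0 // subr0 mul1r mul0r addr0.
Qed.

Lemma deform_ge3 xi u w t : 3 <= t -> deform xi u w t = fun x => (x == xi set0)%:R.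
Proof.
move=> t3; apply/funext => x; rewrite /deform !clamp_1 ?subrr ?mul0r ?add0r ?mul1r //; lra.
Qed.

Lemma deform_ge1 xi u w t : 1 <= t ->
  deform xi u w t = fun x => (1 - clamp (t - 2)) * (Num.max 0 (w x - clamp (t - 1)) +
       push xi (fun y => Num.min (clamp (t - 1)) (w y)) x) +
    clamp (t - 2) * (x == xi set0)%:R.
Proof.
move=> t1; apply/funext => x; rewrite /deform (clamp_1 t1).
by rewrite subrr mul0r add0r mul1r.
Qed.

(** The property provided by [selector_exists]. [small] bounds the size below that of a given
    independent set in finite rank, and is [setT] in infinite rank. *)
Definition selector (I : set (set M)) (small : set (set M)) xi :=
  forall (A : set M) (C : set (set M)), finite_set A -> I A -> finite_set C ->
    (forall s, C s -> [/\ A `<=` s, finite_set s, I s & small s]) ->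
    I (A `|` xi @` C).

Section deform_point.
Variables (I small : set (set M)) (xi : set M -> M).
Variables (T : finType) (p : M -> T) (u w : M -> R).
Hypotheses (Isub : forall s t : set M, t `<=` s -> I s -> I t)
  (smallsub : forall s t : set M, t `<=` s -> small s -> small t)
  (xiP : selector I small xi)
  (u0 : forall x, 0 <= u x) (w0 : forall x, 0 <= w x) (w1 : forall x, w x <= 1)
  (uw : forall x, w x != 0 -> u x != 0)
  (Iu : I [set x | u x != 0]) (finw : finite_set [set x | w x != 0])
  (smallw : small [set x | w x != 0]) (pw : factors p w)
  (w_neq0 : exists x, w x != 0).

Let w_min0 s : 0 <= s -> forall x, 0 <= Num.min s (w x).
Proof. by move=> s0 x; rewrite le_min s0 w0. Qed.

Let w_minp s : factors p (fun x => Num.min s (w x)).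
Proof. by move=> x y /pw ->. Qed.

(** Needed to normalize the mass. A point where [w] is positive persists in the first move;
    afterwards the cut function still has a set of positive level, until the mass at [xi set0] takes
    over. *)
Lemma deform_gt0 t : exists x, 0 < deform xi u w t x.
Proof.
have [x wx] := w_neq0; have {}wx' : 0 < w x by rewrite lt_neqAle eq_sym wx w0.
have ux : 0 < u x by rewrite lt_neqAle eq_sym u0 uw.
have [t1|t1] := leP t 1.
  exists x; rewrite deform_le1 //.
  have := clamp_ge0 t; have := clamp_le1 t.
  by rewrite le_eqVlt => /orP[/eqP->|*]; rewrite ?subrr ?mul0r ?add0r ?mul1r //; nra.
rewrite deform_ge1; last lra.
have s0 : 0 < clamp (t - 1) by apply: clamp_gt0; lra.
have mx : 0 < Num.min (clamp (t - 1)) (w x) by rewrite lt_min s0.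
have [A lA] := level_gt0_exists (@w_minp _) (w_min0 (ltW s0)) mx.
have := push_gt0 xi (@w_minp _) (w_min0 (ltW s0)) lA.
have [c1|c1] := leP 1 (clamp (t - 2)).
  exists (xi set0); have -> : clamp (t - 2) = 1.
    by apply/eqP; rewrite eq_le c1 clamp_le1.
  by rewrite subrr mul0r add0r eqxx mul1r.
exists (xi A); rewrite ltr_pwDl //; last by rewrite mulr_ge0 // clamp_ge0.
by rewrite mulr_gt0 ?subr_gt0 // ltr_wpDl // le_max lexx.
Qed.

(** In the second move every set of positive level of the cut function lies between [{w > s}] and
    the support of [w], so the selector applies over [{w > s}]. *)
Lemma deform_support t : I [set x | deform xi u w t x != 0].
Proof.
have [t1|t1] := leP t 1.
  apply: Isub Iu => x /=; rewrite deform_le1 // => dx.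
  apply/negP => /eqP ux; move: dx; rewrite ux mulr0 add0r => /negP; apply.
  apply/eqP; have [->|/uw] := eqVneq (w x) 0; first by rewrite mulr0.
  by rewrite ux eqxx.
rewrite deform_ge1; last lra.
set s := clamp (t - 1); have s0 : 0 <= s by exact: clamp_ge0.
pose C := [set A | level (fun y => Num.min s (w y)) A != 0].
have finC : finite_set C by exact: finite_level (@w_minp _) (w_min0 s0).
have CP A : C A -> [/\ [set x | s < w x] `<=` A, A `<=` [set x | w x != 0] & C A].
  move=> CA; have l0 : 0 < level (fun y => Num.min s (w y)) A.
    by rewrite lt_neqAle eq_sym level_ge0 CA.
  have [[a Aa] A0 ltA] := level_gt0 (@w_minp _) (w_min0 s0) l0; split => //.
    (* Where [w] exceeds [s] the cut function has its maximal value [s], so a nonempty set of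
       positive level cannot omit such a point. *)
    move=> x /= sx; apply: contrapT => /(ltA _ _ Aa).
    rewrite [X in X < _](min_idPl (ltW sx)) => h.
    have : Num.min s (w a) <= s by rewrite ge_min lexx.
    by rewrite leNgt h.
  by move=> x /A0 /=; rewrite lt_min => /andP[_ wx]; rewrite gt_eqF.
have Iw : I [set x | w x != 0] by apply: Isub Iu => x /uw.
have CQ (B A : set M) : A `<=` [set x | w x != 0] -> B `<=` A ->
    [/\ B `<=` A, finite_set A, I A & small A].
  move=> Aw BA; split => //; [exact: sub_finite_set finw| exact: Isub Iw|].
  exact: smallsub smallw.
have [t2|t2] := leP t 2.
  have -> : clamp (t - 2) = 0 by apply: clamp_0; lra.
  have /(Isub _) : I ([set x | s < w x] `|` xi @` C).
    have sw : [set x | s < w x] `<=` [set x | w x != 0].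
      by move=> x /= sx; rewrite gt_eqF //; exact: le_lt_trans sx.
    apply: xiP => //; [exact: sub_finite_set finw|exact: Isub Iw|].
    by move=> A /CP[? ? _]; exact: CQ.
  apply => x /=; rewrite subr0 mul1r mul0r addr0.
  have [ws|ws] := leP (w x) s; last by left.
  rewrite (max_idPl _) ?subr_le0 // add0r => /push_neq0[A <- lA].
  by right; exists A => //; rewrite /C /= gt_eqF.
(* After time 2 the threshold is 1, which bounds [w], so only points [xi A] carry mass; [set0] joins
   [C] for the final Dirac mass. *)
have s1 : s = 1 by apply: clamp_1; lra.
have /(Isub _) : I (set0 `|` xi @` (set0 |` C)).
  apply: xiP => //; [exact: Isub Iw|by rewrite finite_setU; split|].
  by move=> A [->|/CP[? ? _]]; exact: CQ.
apply => x /=; rewrite s1 (max_idPl _) ?subr_le0 // add0r => dx; right.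
have [->|nx] := eqVneq x (xi set0); first by exists set0 => //; left.
move: dx; rewrite (negbTE nx) mulr0 addr0 mulf_eq0 => /norP[_].
rewrite -s1 => /push_neq0[A <- lA].
by exists A => //; right; rewrite /C /= gt_eqF.
Qed.

End deform_point.
End deformation.

(** * Families of step functions depending continuously on a parameter *)

Section tame_families.
Variables (R : realType) (M : choiceType).

Lemma clamp_continuous : continuous (@clamp R).
Proof.
move=> a; apply: (@continuous_min R R^o (fun=> 1) (fun a => Num.max 0 a)).
  exact: cst_continuous.
by apply: (@continuous_max R R^o (fun=> 0) id) => //; exact: cst_continuous.
Qed.

(* The partition does not depend on [z], so that pointwise continuity is
   uniform on [M] and suprema over subsets of [M] vary continuously. *)
Definition tame (Z : topologicalType) (v : Z -> M -> R) :=
  (exists (T : finType) (p : M -> T), forall z, factors p (v z)) /\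
  (forall x, continuous (fun z => v z x)).

Variable Z : topologicalType.
Implicit Types u v w : Z -> M -> R.

Lemma continuous_level v A : tame v -> (forall z x, 0 <= v z x) ->
  continuous (fun z => level (v z) A).
Proof. by move=> [[T [p pv]] cv] v0; exact: level_continuous pv v0 cv. Qed.

Lemma finite_level_tame v : tame v -> (forall z x, 0 <= v z x) ->
  exists2 F : set (set M), finite_set F & forall z A, level (v z) A != 0 -> F A.
Proof.
move=> [[T [p pv]] cv] v0; eexists; first exact: (finite_saturated p).
move=> z A lA; apply: (level_gt0_saturated (pv z) (v0 z)).
by rewrite lt_neqAle eq_sym lA level_ge0.
Qed.

Lemma tame_push xi w : tame w -> (forall z x, 0 <= w z x) ->
  tame (fun z => push xi (w z)).
Proof.
move=> tw w0; have [[T [p pw]] cw] := tw; split.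
  (* The value at [x] depends only on which unions of fibres of [p] are sent to [x] by [xi]. *)
  exists {set {set T}}, (fun x => [set S : {set T} | `[< xi (p @^-1` [set` S]) = x >]]%SET).
  move=> z x y exy; rewrite !(push_sum _ (pw z) (w0 z)).
  apply: eq_big_seq => A; rewrite in_fset_set; last exact: finite_saturated.
  move=> /set_mem[S _ <-]; suff -> : `[< xi (p @^-1` [set` S]) = x >] =
    `[< xi (p @^-1` [set` S]) = y >] by [].
  by have := congr1 (fun X : {set {set T}} => S \in X) exy; rewrite !inE.
move=> x z0; under eq_fun do rewrite (push_sum _ (pw _) (w0 _)).

apply: cvg_big => [|A _]; first exact: add_continuous.
case: ifP => _; last exact: cvg_cst.
exact: (continuous_level tw w0).
Qed.

Lemma tame_comp (f : Z -> R -> R) w : tame w ->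
  (forall x, continuous (fun z => f z (w z x))) -> tame (fun z x => f z (w z x)).
Proof.
move=> [[T [p pw]] cw] cf; split => //; exists T, p => z x y pxy.
by rewrite (pw z x y pxy).
Qed.

Section clamped_parameter.
Variable t : Z -> R.
Hypothesis ct : continuous t.

Lemma continuous_clampB (c : R) : continuous (fun z => clamp (t z - c)).
Proof.
move=> z; apply: (@continuous_comp _ _ _ (fun z => t z - c) (@clamp R)).
  by apply: cvgB; [exact: ct|exact: cvg_cst].
exact: clamp_continuous.
Qed.

Lemma tame_cut w : tame w -> tame (fun z y => Num.min (clamp (t z - 1)) (w z y)).
Proof.
move=> tw; apply: (@tame_comp (fun z r => Num.min (clamp (t z - 1)) r)) => // x z.
apply: (@continuous_min R Z (fun z => clamp (t z - 1)) (fun z => w z x)).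
  exact: continuous_clampB.
by case: tw => _; exact.
Qed.

End clamped_parameter.

Lemma tame_deform xi u w (t : Z -> R) : tame u -> tame w ->
  (forall z x, 0 <= w z x) -> continuous t ->
  tame (fun z => deform xi (u z) (w z) (t z)).
Proof.
move=> tu tw w0 ct.
have cclamp := continuous_clampB ct.
have c0 : continuous (fun z => clamp (t z)).
  suff -> : (fun z => clamp (t z)) = (fun z => clamp (t z - 0)) by exact: cclamp.
  by apply/funext => z; rewrite subr0.
have tm := tame_cut ct tw.
have [[Tp [pp ppP]] cp] : tame (fun z => push xi (fun y => Num.min (clamp (t z - 1)) (w z y))).
  by apply: (tame_push xi tm) => z x; rewrite le_min clamp_ge0 w0.
have [[Tu [pu puP]] cu] := tu; have [[Tw [pw pwP]] cw] := tw.
split.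
  exists (Tp * Tu * Tw * bool)%type, (fun x => (pp x, pu x, pw x, x == xi set0)).
  move=> z x y [h1 h2 h3 h4]; rewrite /deform.
  by rewrite (ppP z x y h1) (puP z x y h2) (pwP z x y h3) h4.
move=> x z; rewrite /deform.
have c1 : {for z, continuous (fun=> 1 : R)} by exact: cst_continuous.
apply: cvgD; first by apply: cvgM (cu x z); apply: cvgB c1 (c0 z).
apply: cvgM (c0 z) _; apply: cvgD.
  apply: cvgM; first by apply: cvgB c1 (cclamp 2 z).
  apply: cvgD (cp x z).
  apply: (@continuous_max R Z (fun=> 0) (fun z => w z x - clamp (t z - 1))).
    exact: cst_continuous.
  exact: cvgB (cw x z) (cclamp 1 z).
by apply: cvgM (cclamp 2 z) _; exact: cvg_cst.
Qed.

Lemma tame_sum (K : Type) (s : seq K) (c : Z -> K -> R) (e : K -> M -> bool) :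
  (forall k, continuous (fun z => c z k)) ->
  tame (fun z x => \sum_(k <- s) c z k * (e k x)%:R).
Proof.
move=> cc; split.
  exists {ffun 'I_(size s) -> bool}, (fun x => [ffun i => e (tnth (in_tuple s) i) x]).
  move=> z x y /ffunP exy; rewrite [LHS]big_tnth [RHS]big_tnth; apply: eq_bigr => i _.
  by have := exy i; rewrite !ffunE => ->.
move=> x z; apply: cvg_big => [|k _]; first exact: add_continuous.
by apply: cvgM; [exact: cc|exact: cvg_cst].
Qed.

End tame_families.

(** * Maps into realizations *)

Section realization_topology.
Variables (R : realType).

Lemma ptws_continuous (Z Y : topologicalType) (V : Type) (f : Z -> V -> Y) :
  (forall v, continuous (fun z => f z v)) ->
  continuous (f : Z -> {ptws V -> Y}).
Proof.
move=> cf z; apply/cvg_sup => v U.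
have /= -> := @nbhsE (initial_topology (fun g : V -> Y => g v)) (f z).
case=> B [[C oC <- ?]] /filterS; apply.
by apply: cf; exact: open_nbhs_nbhs.
Qed.

Variables (V : choiceType) (K : set (set V)).
Local Notation X := (realization R K).

Lemma realization_inj (x y : X) : bary x = bary y -> x = y.
Proof.
case: x y => [bx x0 xK x1] [by_ y0 yK y1] /= exy.
case: _ / exy y0 yK y1 => y0 yK y1.
by congr Realization; exact: Prop_irrelevance.
Qed.

Lemma ptws_eval_continuous (v : V) : continuous (fun f : {ptws V -> R} => f v).
Proof. exact: (@proj_continuous V (fun=> R) v). Qed.

Lemma bary_continuous (v : V) : continuous (fun x : X => bary x v).
Proof.
apply/continuousP => A oA; rewrite realization_openE => s Ks.
exists ((fun f : {ptws V -> R} => f v) @^-1` A) => //.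
by apply: open_comp => // f _; exact: ptws_eval_continuous.
Qed.

(** The weak topology can be finer than pointwise convergence, so the vertices in use are confined
    to a finite [F]. Then finitely many faces matter: on a face carrying [G z] the trace of an open
    set is pointwise open, and a face not carrying it is avoided nearby, since a coordinate off that
    face stays nonzero. *)
Lemma realization_continuous (Z : topologicalType) (G : Z -> X) (F : {fset V}) :
  (forall z v, bary (G z) v != 0 -> v \in F) ->
  (forall v, continuous (fun z => bary (G z) v)) -> continuous G.
Proof.
move=> GF cG z U; rewrite nbhsE => -[W [oW WGz] /filterS]; apply.
have near_face (S : {fset V}) : K [set` S] ->
    \forall z' \near z, closed_simplex [set` S] (G z') -> W (G z').
  move=> KS; have [O oO eO] := (oW : realization_open W) _ KS.
  have [SGz|] := pselect (closed_simplex [set` S] (G z)).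
    have : \forall z' \near z, O (bary (G z')).
      have /(_ O) := @ptws_continuous Z R V (fun z => bary (G z)) cG z; apply.
      apply: (@open_nbhs_nbhs {ptws V -> R}); split => //.
      by have [] : (bary (K:=K) @^-1` O `&` closed_simplex [set` S]) (G z) by rewrite -eO.
    apply: filterS => z' Oz' Sz'.
    by have [] : (W `&` closed_simplex [set` S]) (G z') by rewrite eO.
  move=> /existsNP[v /not_implyP[Gzv /= vS]].
  have : \forall z' \near z, bary (G z') v != 0.
    by apply: (cG v z [set r | r != 0]); apply: open_nbhs_nbhs; split => //; exact: open_neq.
  by apply: filterS => z' Gz'v Sz'; exfalso; apply: vS; exact: Sz'.
have : \forall z' \near z, forall S, S \in fpowerset F -> K [set` S] ->
    closed_simplex [set` S] (G z') -> W (G z').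
  have : \forall z' \near z, (\bigcap_(S in [set` fpowerset F])
      [set z' | K [set` S] -> closed_simplex [set` S] (G z') -> W (G z')]) z'.
    apply: filter_bigI => S _; have [KS|nKS] := pselect (K [set` S]).
      by apply: filterS (near_face S KS) => z' H _.
    by apply: nearW => z' /nKS.
  by apply: filterS => z' H S SF; exact: H.
move=> near_all; suff : \forall z' \near z, W (G z') by [].
apply: filterS near_all => z'.
pose S := [fset v in F | bary (G z') v != 0]%fset.
have SE : [set` S] = [set v | bary (G z') v != 0].
  apply/seteqP; split=> v; rewrite /= !inE; first by case/andP.
  by move=> Gv; rewrite Gv andbT; exact: (GF z').
move=> /(_ S); apply; last by rewrite /closed_simplex SE.
- by rewrite fpowersetE; apply/fsubsetP => v; rewrite !inE => /andP[].
- by rewrite SE; exact: bary_supp.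
Qed.

Lemma fsum_fset (a : V -> R) (F : {fset V}) :
  (forall v, a v != 0 -> v \in F) -> \sum_(v \in [set: V]) a v = \sum_(v <- F) a v.
Proof.
move=> aF; rewrite (fsbigE F) ?fset_uniq //.
  by apply: eq_bigl => v; rewrite in_setT.
by move=> v _ vF; apply/eqP; apply: contraNT vF; exact: aF.
Qed.

Lemma barycenter_exists (a : V -> R) : (forall v, 0 <= a v) ->
  (exists v, 0 < a v) -> K [set v | a v != 0] -> finite_set [set v | a v != 0] ->
  exists x : X, forall v, bary x v = a v / \sum_(v \in [set: V]) a v.
Proof.
move=> a0 [v av] Ka fina.
set s := \sum_(v \in [set: V]) a v.
have sE : s = \sum_(v <- fset_set [set v | a v != 0]) a v.
  by apply: fsum_fset => w aw; rewrite in_fset_set //; exact/mem_set.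
have s_gt0 : 0 < s.
  rewrite sE (big_rem v) /=; last first.
    by rewrite in_fset_set //; apply/mem_set; rewrite /= gt_eqF.
  by rewrite ltr_pwDl // sumr_ge0.
have supE : [set v | a v / s != 0] = [set v | a v != 0].
  by apply/seteqP; split=> w /=; rewrite mulf_eq0 negb_or invr_eq0 (gt_eqF s_gt0) andbT.
have b0 w : 0 <= a w / s by rewrite divr_ge0 // ltW.
have bK : K [set v | a v / s != 0] by rewrite supE.
have b1 : \sum_(v \in [set: V]) a v / s = 1.
  rewrite (fsum_fset (F := fset_set [set v | a v != 0])); last first.
    move=> w; rewrite mulf_eq0 negb_or => /andP[aw _].
    by rewrite in_fset_set //; exact/mem_set.
  by rewrite -mulr_suml -sE divff // gt_eqF.
by exists (Realization b0 bK b1).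
Qed.

Lemma barycenter_map (Z : topologicalType) (a : Z -> V -> R) (F : {fset V}) :
  (forall z v, 0 <= a z v) -> (forall z, exists v, 0 < a z v) ->
  (forall z, K [set v | a z v != 0]) ->
  (forall z v, a z v != 0 -> v \in F) ->
  (forall v, continuous (fun z => a z v)) ->
  exists2 G : Z -> X, continuous G &
    forall z v, bary (G z) v = a z v / \sum_(v \in [set: V]) a z v.
Proof.
move=> a0 apos aK aF ca.
have fina z : finite_set [set v | a z v != 0].
  by apply: (sub_finite_set _ (finite_fset F)) => v /= /aF.
have /choice[G GE] : forall z, exists x : X,
    forall v, bary x v = a z v / \sum_(v \in [set: V]) a z v.
  by move=> z; exact: barycenter_exists.
exists G => //; apply: (@realization_continuous _ _ F) => [z v|v z].
  by rewrite GE mulf_eq0 negb_or => /andP[/aF].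
have s_gt0 : \sum_(v <- F) a z v != 0.
  have [w aw] := apos z; rewrite gt_eqF // (big_rem w) /=.
    by rewrite ltr_pwDl // sumr_ge0.
  by apply: (aF z); rewrite gt_eqF.
have -> : (fun z => bary (G z) v) = (fun z => a z v / \sum_(v <- F) a z v).
  by apply/funext => z'; rewrite GE (fsum_fset (aF z')).
apply: cvgM; first exact: ca.
by apply: cvgV => //; apply: cvg_big => [|w _]; [exact: add_continuous|exact: ca].
Qed.

End realization_topology.

(** * Kuhn weights on a grid *)

Section kuhn_weights.
Variables (R : realType) (k N : nat).
Local Notation n := k.+1.
Local Notation grid := {ffun 'I_n -> 'I_(N + N).+1}.
Implicit Types (g h : grid) (y z : 'rV[R]_n).

(* The grid node [g] stands for the lattice point [g - (N, .., N)], and the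
   weight is positive on the open star of that point in the Kuhn (Freudenthal)
   triangulation of space, scaled by [1 / N]. *)
Definition grid_diff g y (i : 'I_n) : R := N%:R * y ord0 i + N%:R - (g i)%:R.

Definition kuhn g y : R :=
  \prod_(i < n) \prod_(j < n)
     Num.max 0 (1 - Num.max 0 (grid_diff g y i) - Num.max 0 (- grid_diff g y j)).

Lemma kuhn_ge0 g y : 0 <= kuhn g y.
Proof. by apply: prodr_ge0 => i _; apply: prodr_ge0 => j _; rewrite le_max lexx. Qed.

Lemma kuhn_le1 g y : kuhn g y <= 1.
Proof.
apply: prodr_ile1 => i _; apply/andP; split.
  by apply: prodr_ge0 => j _; rewrite le_max lexx.
apply: prodr_ile1 => j _; rewrite le_max lexx ge_max ler01 /=.
rewrite -addrA gerDl -opprD oppr_le0 addr_ge0 // le_max lexx //.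
Qed.

(** All factors are positive exactly when 0 and the differences [grid_diff g y i] have spread less
    than 1, which describes the open star of [g]. *)
Lemma kuhn_neq0 g y : kuhn g y != 0 <-> forall i j,
  Num.max 0 (grid_diff g y i) + Num.max 0 (- grid_diff g y j) < 1.
Proof.
split=> [/prodf_neq0 H i j|H].
  have /prodf_neq0/(_ j isT) := H i isT.
  apply: contraNT; rewrite -leNgt => le1; apply/eqP/max_idPl; lra.
apply/prodf_neq0 => i _; apply/prodf_neq0 => j _.
by rewrite gt_eqF // lt_max; apply/orP; right; have := H i j; lra.
Qed.

Lemma kuhn_diff g y i : kuhn g y != 0 -> -1 < grid_diff g y i < 1.
Proof.
move=> /kuhn_neq0/(_ i i); rewrite /Num.max.
by do 2 case: ifPn; rewrite -?leNgt => *; apply/andP; split; lra.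
Qed.

Lemma kuhn_continuous (Z : topologicalType) (y : Z -> 'rV[R]_n) g (t : Z) :
  (forall i, {for t, continuous (fun t => y t ord0 i)}) ->
  {for t, continuous (fun t => kuhn g (y t))}.
Proof.
move=> cy; apply: cvg_big => [|i _]; first exact: mul_continuous.
apply: cvg_big => [|j _]; first exact: mul_continuous.
have cd l : {for t, continuous (fun t => grid_diff g (y t) l)}.
  apply: cvgB; last exact: cvg_cst.
  apply: cvgD; last exact: cvg_cst.
  by apply: cvgM; [exact: cvg_cst|exact: cy].
have cm (f : Z -> R) : {for t, continuous f} ->
    {for t, continuous (fun t => Num.max 0 (f t))}.
  by move=> cf; apply: (@continuous_max R _ (fun=> 0) f); [exact: cvg_cst|exact: cf].
apply: (cm _); apply: cvgB; first by apply: cvgB; [exact: cvg_cst|exact: cm].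
by apply: (cm _); apply: cvgN; exact: cd.
Qed.

(** Rounding every coordinate down gives a node with all differences nonnegative and less than 1;
    the bound on [y] keeps it in the grid. *)
Lemma kuhn_cover y : (forall i, `|y ord0 i| <= 1) -> exists g, kuhn g y != 0.
Proof.
move=> y1.
have pos i : 0 <= N%:R * y ord0 i + N%:R.
  by have := y1 i; rewrite ler_norml => /andP[? ?]; have := ler0n R N; nra.
have lt i : (Num.truncn (N%:R * y ord0 i + N%:R) < (N + N).+1)%N.
  rewrite ltnS truncn_le_nat -natr1 natrD.
  have := y1 i; rewrite ler_norml => /andP[? ?]; have := ler0n R N; nra.
exists [ffun i => Ordinal (lt i)]; apply/kuhn_neq0 => i j.
have d l : 0 <= grid_diff [ffun i => Ordinal (lt i)] y l < 1.
  rewrite /grid_diff ffunE /=; have := truncn_itv (pos l).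
  by rewrite -[X in _ < X]natr1 => /andP[? ?]; apply/andP; split; lra.
have /andP[i0 i1] := d i; have /andP[j0 j1] := d j.
by rewrite (max_idPr i0) (max_idPl _) ?oppr_le0 //; lra.
Qed.

(** In scaled coordinates both points are within 1 of the node [g]; this is the constant 2 of
    [sphere_lebesgue]. *)
Lemma kuhn_near g y z i : kuhn g y != 0 -> kuhn g z != 0 ->
  N%:R * `|y ord0 i - z ord0 i| < 2.
Proof.
move=> /(kuhn_diff i)/andP[a b] /(kuhn_diff i)/andP[c d].
rewrite -[X in X * _](ger0_norm (ler0n R N)) -normrM mulrBr ltr_norml.
by rewrite /grid_diff in a b c d; apply/andP; split; lra.
Qed.

(** For incomparable nodes two of the spread inequalities would add up to less than 2, while the two
    integer gaps contribute at least 2. *)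
Lemma kuhn_chain g h y : kuhn g y != 0 -> kuhn h y != 0 ->
  (forall i, (g i <= h i)%N) \/ (forall i, (h i <= g i)%N).
Proof.
move=> /kuhn_neq0 gy /kuhn_neq0 hy; apply: contrapT => /not_orP[].
move=> /existsNP[i /negP]; rewrite -ltnNge => hi.
move=> /existsNP[j /negP]; rewrite -ltnNge => gj.
have := gy j i; have := hy i j; rewrite /grid_diff.
move: hi gj; rewrite -(ler_nat R) -(ler_nat R (g j).+1) -!natr1 => hi gj.
by rewrite /Num.max; do 4 case: ifPn; rewrite -?leNgt; lra.
Qed.

(* A point with one coordinate on the lattice lies in a [k]-dimensional
   simplex: the nodes of its carrier form a chain whose coordinate sums are
   distinct and differ by at most [k]. *)
Lemma kuhn_card y i0 : `|y ord0 i0| = 1 ->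
  (#|[set g : grid | (kuhn g y != 0)%R]%SET| <= n)%N.
Proof.
move=> y1; pose S := [set g : grid | kuhn g y != 0]%SET; rewrite -/S.
have SE g : (g \in S) = (kuhn g y != 0) by rewrite inE.
have [->|[g0 g0S]] := set_0Vmem S; first by rewrite cards0.
pose sz g := (\sum_(i < n) g i)%N.
have [m mS min_m] : exists2 m, m \in S & forall g, g \in S -> (sz m <= sz g)%N.
  by case: (@arg_minnP _ g0 (mem S) sz g0S) => m mS minm; exists m.
have le1 g h i : g \in S -> h \in S -> (g i <= (h i).+1)%N.
  rewrite !SE => /(kuhn_diff i)/andP[a b] /(kuhn_diff i)/andP[c d].
  rewrite leqNgt; apply/negP; rewrite -(ler_nat R) -!natr1 => hg.
  by rewrite /grid_diff in a b c d; lra.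
(* The scaled coordinate at [i0] is an integer, 0 or twice [N], so all nodes at distance less than 1
   share it. *)
have le0 g h : g \in S -> h \in S -> (g i0 <= h i0)%N.
  rewrite !SE => /(kuhn_diff i0)/andP[a b] /(kuhn_diff i0)/andP[c d].
  have [c0 c0E] : exists c0 : nat, N%:R * y ord0 i0 + N%:R = c0%:R :> R.
    have [y0|y0] := leP 0 (y ord0 i0).
      exists (N + N)%N; move: y1; rewrite (ger0_norm y0) => ->.
      by rewrite mulr1 natrD.
    exists 0%N; move: y1; rewrite (ltr0_norm y0) => /eqP; rewrite eqr_oppLR => /eqP ->.
    by rewrite mulrN1 addNr.
  rewrite /grid_diff c0E in a b c d.
  rewrite leqNgt; apply/negP => hg.
  have [|] := leqP (g i0) c0.
    rewrite -(ler_nat R) => h1; move: hg; rewrite -(ler_nat R) -!natr1; lra.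
  rewrite -(ler_nat R) -natr1 => h1; lra.
have sz_le g h : g \in S -> h \in S -> (sz g <= sz h + k)%N.
  move=> gS hS; rewrite /sz (bigD1 i0) //= [X in (_ <= X + _)%N](bigD1 i0) //= -addnA.
  apply: leq_add; first exact: le0.
  apply: (@leq_trans (\sum_(i < n | i != i0) (h i + 1))).
    by apply: leq_sum => i _; rewrite addn1; exact: le1.
  by rewrite big_split /= sum1_card cardC1 card_ord.
have sz_inj : {in S &, injective (fun g => inord (sz g - sz m) : 'I_n)}.
  move=> g h gS hS /(congr1 val); rewrite /= !inordK; first last.
  - by rewrite ltnS leq_subLR; exact: sz_le.
  - by rewrite ltnS leq_subLR; exact: sz_le.
  move=> esz; have {}esz : sz g = sz h.
    by have := min_m _ gS; have := min_m _ hS; lia.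
  wlog gh : g h gS hS esz / forall i, (g i <= h i)%N.
    move=> W; move: (gS) (hS); rewrite !SE => gy hy.
    by have [?|?] := kuhn_chain gy hy; [|symmetry]; exact: W.
  apply/ffunP => i; apply: val_inj; apply/eqP.
  have /leqif_sum/leqifP := fun i (_ : true) => leqif_eq (gh i).
  rewrite -/(sz g) -/(sz h) esz.
  case: ifP => [/forallP/(_ i)//|_]; by rewrite ltnn.
rewrite -(card_in_imset sz_inj) -[X in (_ <= X)%N](card_ord n).
exact: max_card.
Qed.

End kuhn_weights.

(** * Maps from spheres *)

(* Cover the compact set by the open sets [{x | bary x v < eps v off G}], [G]
   finite, where [eps v] is a value of the coordinate [v] attained on the set. *)
Lemma compact_vertices (R : realType) (V : choiceType) (K : set (set V))
    (A : set (realization R K)) :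
  (forall s, K s -> finite_set s) -> compact A ->
  exists F : {fset V}, forall x, A x -> forall v, bary x v != 0 -> v \in F.
Proof.
move=> finK /compact_near_coveringP cA.
have /choice[e eP] : forall v, exists e : R, 0 < e /\
    forall x, A x -> bary x v != 0 -> exists2 y, A y & bary y v = e.
  move=> v; have [[y [Ay yv]]|H] := pselect (exists y, A y /\ bary y v != 0).
    exists (bary y v); split; last by move=> *; exists y.
    by rewrite lt_neqAle eq_sym yv bary_ge0.
  by exists 1; split => // x Ax xv; exfalso; apply: H; exists x.
pose U (G : {fset V}) := [set x : realization R K | forall v, v \notin G -> bary x v < e v].
(* On a given face only the finitely many conditions at its vertices matter. *)
have oU G : open (U G).
  rewrite realization_openE => s Ks.
  exists [set f | forall v, v \in fset_set s -> v \notin G -> f v < e v].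
    rewrite openE => f Of; rewrite /interior.
    have : \forall g \near (f : {ptws V -> R}), (\bigcap_(v in [set` fset_set s])
        [set g : {ptws V -> R} | v \notin G -> g v < e v]) g.
      apply: filter_bigI => v vs; have [vG|vG] := boolP (v \in G).
        rewrite (_ : [set g | _] = setT); first exact: filterT.
        by apply/seteqP; split=> // g _ /=; rewrite vG.
      have := @ptws_eval_continuous R V v f => /(_ [set r | r < e v]) H.
      have {}H : nbhs (f : {ptws V -> R}) [set g : {ptws V -> R} | g v < e v].
        apply: H; apply: open_nbhs_nbhs; split; first exact: open_lt.
          exact: (Of v vs vG).
      by apply: filterS H => g gv _.
    by apply: filterS => g H v vs; exact: H.
  apply/seteqP; split=> x [] Ux xs; split => //.
    by move=> v _; exact: Ux.
  move=> v vG; have [vs|vs] := boolP (v \in fset_set s); first exact: Ux.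
  have [->|xv] := eqVneq (bary x v) 0; first by have [] := eP v.
  have := xs v xv => sv; move: vs; rewrite in_fset_set; last exact: finK.
  by rewrite mem_set.
(* The filter of all large enough finite vertex sets turns compactness into the existence of one [G]
   for the whole of [A]. *)
pose FF := filter_from [set: {fset V}] (fun G => [set H | (G `<=` H)%fset]).
have filFF : Filter FF.
  apply: filter_from_filter; first by exists fset0.
  move=> G H _ _; exists (G `|` H)%fset => // L /=.
  by rewrite fsubUset => /andP[].
have : \forall G \near FF, A `<=` U G.
  apply: (cA _ FF (fun G x => U G x)) => x Ax.
  pose S := fset_set [set v | bary x v != 0].
  exists (U S, [set H | (S `<=` H)%fset]).
    split => /=; last by exists S.
    apply: open_nbhs_nbhs; split => // v.
    rewrite in_fset_set; last exact: (finK _ (bary_supp x)).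
    rewrite notin_setE /= => /negP/negPn/eqP xv0.
    by rewrite xv0; case: (eP v).
  move=> [y H] [/= Sy SH] v vH; apply: Sy; apply: contra vH.
  by move: SH => /fsubsetP; exact.
move=> [G _ /(_ G (fsubset_refl _)) AU].
exists G => x Ax v xv; apply: contrapT => /negP vG.
have [e0 /(_ x Ax xv)[y Ay yv]] := eP v.
by have := AU y Ay v vG; rewrite yv ltxx.
Qed.

Lemma continuous_inv (R : realType) (Z : topologicalType) (c : Z -> R) z :
  c z != 0 -> {for z, continuous c} -> {for z, continuous (fun z => (c z)^-1)}.
Proof. by move=> cz0 cc; apply: cvgV. Qed.

(** The factor vanishes for [q] at most 1/8, which hides the discontinuities of [h] where [q] is not
    positive. *)
Lemma cutoff_continuous (R : realType) (Z : topologicalType) (q h : Z -> R) : continuous q ->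
  (forall z, 0 < q z -> {for z, continuous h}) ->
  continuous (fun z => clamp (8 * q z - 1) * h z).
Proof.
move=> cq ch z; have [q0|q0] := ltP 0 (q z).
  apply: cvgM; last exact: ch.
  apply: (@continuous_comp _ _ _ (fun z => 8 * q z - 1) (@clamp R)).
    by apply: cvgB; [apply: cvgM; [exact: cvg_cst|exact: cq]|exact: cvg_cst].
  exact: clamp_continuous.
rewrite /continuous_at clamp_0; last lra.
rewrite mul0r; apply: cvg_near_cst.
have : \forall z' \near z, q z' < 8^-1.
  by apply: (@cvgr_lt _ _ _ _ q (q z) (cq z)); rewrite (le_lt_trans q0) // invr_gt0.
by apply: filterS => z' qz'; rewrite clamp_0 ?mul0r //; lra.
Qed.

Section sphere.
Variables (R : realType) (k : nat).
Local Notation E := 'rV[R]_k.+1.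
Implicit Types z : E.

Definition sqn z : R := \sum_(i < k.+1) z ord0 i ^+ 2.

Lemma sqn_ge0 z : 0 <= sqn z.
Proof. by apply: sumr_ge0 => i _; exact: sqr_ge0. Qed.

Lemma sqn_continuous : continuous sqn.
Proof.
suff H (Z : topologicalType) (y : Z -> E) : (forall i, continuous (fun t => y t ord0 i)) ->
    continuous (fun t => sqn (y t)).
  by apply: (H _ id) => i; exact: coord_continuous.
move=> cy t; apply: cvg_big => [|i _]; first exact: add_continuous.
under eq_fun do rewrite expr2.
by rewrite expr2; apply: cvgM; exact: cy.
Qed.

Lemma sqnZ a z : sqn (a *: z) = a ^+ 2 * sqn z.
Proof. by rewrite /sqn mulr_sumr; apply: eq_bigr => i _; rewrite mxE exprMn. Qed.

Lemma sqn_gt0 z : (0 < sqn z) = (z != 0).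
Proof.
rewrite lt_neqAle sqn_ge0 andbT eq_sym; congr negb; apply/eqP/eqP => [|->].
  move=> /(psumr_eq0P (fun i _ => sqr_ge0 (z ord0 i))) H.
  apply/rowP => i; rewrite mxE; apply/eqP; rewrite -sqrf_eq0; exact/eqP/H.
by rewrite /sqn big1 // => i _; rewrite mxE expr0n.
Qed.

(** Radial projection to the Euclidean sphere, where [f] is continuous. Its companion [hat] projects
    to the sup-norm sphere, where some coordinate is on the lattice and [kuhn_card] applies. *)
Definition dir z : E := (Num.sqrt (sqn z))^-1 *: z.

Lemma sqn_dir z : 0 < sqn z -> sqn (dir z) = 1.
Proof.
by move=> z0; rewrite sqnZ exprVn sqr_sqrtr ?sqn_ge0 // mulVf // gt_eqF.
Qed.

Lemma dir_id z : sqn z = 1 -> dir z = z.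
Proof. by rewrite /dir => ->; rewrite sqrtr1 invr1 scale1r. Qed.

Lemma dirZ a z : 0 < a -> dir (a *: z) = dir z.
Proof.
move=> a0; rewrite /dir sqnZ sqrtrM ?sqr_ge0 // sqrtr_sqr gtr0_norm //.
by rewrite invfM scalerA mulrAC mulVf ?mul1r // gt_eqF.
Qed.

Lemma near_sqn_gt0 z : 0 < sqn z -> \forall z' \near z, 0 < sqn z'.
Proof. exact: (@cvgr_gt _ _ _ _ sqn (sqn z) (@sqn_continuous z) 0). Qed.

Lemma continuous_scaler (c : E -> R) z : {for z, continuous c} ->
  {for z, continuous (fun z => c z *: z)}.
Proof. by move=> cc; apply: (@cvgZ R E E (nbhs z) _ c id (c z) z cc); exact: cvg_id. Qed.

Lemma dir_continuous z : 0 < sqn z -> {for z, continuous dir}.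
Proof.
move=> z0; apply: (@continuous_scaler (fun z => (Num.sqrt (sqn z))^-1)).
apply: (@continuous_inv R E (fun z => Num.sqrt (sqn z))).
  by rewrite gt_eqF // sqrtr_gt0.
apply: (@continuous_comp _ _ _ sqn Num.sqrt); first exact: sqn_continuous.
exact: sqrt_continuous.
Qed.

(* [`|z|] is the sup norm. *)
Definition hat z : E := `|z|^-1 *: z.

Lemma norm_hat z : 0 < sqn z -> `|hat z| = 1.
Proof.
rewrite sqn_gt0 => z0.
by rewrite /hat mx_normZ normfV normr_id mulVf // normr_eq0.
Qed.

Lemma dir_hat z : 0 < sqn z -> dir (hat z) = dir z.
Proof. by rewrite sqn_gt0 => z0; rewrite /hat dirZ // invr_gt0 normr_gt0. Qed.

Lemma hat_continuous z : 0 < sqn z -> {for z, continuous hat}.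
Proof.
rewrite sqn_gt0 => z0; apply: (@continuous_scaler (fun z => `|z|^-1)).
by apply: (@continuous_inv R E Num.norm); [rewrite normr_eq0|exact: norm_continuous].
Qed.

Lemma norm_coord z : `|z| = 1 ->
  (forall i, `|z ord0 i| <= 1) /\ exists i, `|z ord0 i| = 1.
Proof.
have nE : `|z| = mx_norm z by [].
move=> z1; split=> [i|].
  rewrite -z1 nE mx_normrE; exact: (le_bigmax _ (fun ij => `|z ij.1 ij.2|) (ord0, i)).
have [|[i j] /=] := @mx_norm_neq0 R 1 k.+1 z; first by rewrite -nE z1 oner_neq0.
by rewrite -nE z1 (ord1 i) => h; exists j.
Qed.

Lemma compact_unit_sphere : compact (@unit_sphere R k.+1).
Proof.
apply: bounded_closed_compact.
  exists 1; split => // e e1 z /= z1.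
  apply: le_trans (ltW e1); have -> : `|z| = mx_norm z by [].
  rewrite mx_normrE; apply/bigmax_leP; split=> // -[i j] _ /=.
  rewrite (ord1 i) -[leRHS]ger0_norm // -ler_sqr ?nnegrE //.
  by rewrite !real_normK ?num_real // expr1n -z1 (bigD1 j) //= lerDl sumr_ge0 // => l _; exact: sqr_ge0.
have -> : @unit_sphere R k.+1 = sqn @^-1` [set 1] by [].
apply: closed_comp; [by move=> z _; exact: sqn_continuous|exact: closed_eq].
Qed.

Lemma compact_sup_sphere : compact [set z : E | `|z| = 1].
Proof.
apply: bounded_closed_compact.
  by exists 1; split => // e e1 z /= ->; exact: ltW.
have -> : [set z : E | `|z| = 1] = Num.norm @^-1` [set 1] by [].
apply: closed_comp; [by move=> z _; exact: norm_continuous|exact: closed_eq].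
Qed.

End sphere.

Section finite_deformation.
Variables (R : realType) (M : choiceType) (Z : topologicalType).
Variables (xi : set M -> M) (u w : Z -> M -> R) (t : Z -> R).
Hypotheses (tw : tame w) (w0 : forall z x, 0 <= w z x) (ct : continuous t).

Lemma deform_finite (F : set M) : finite_set F ->
  (forall z x, u z x != 0 -> F x) -> (forall z x, w z x != 0 -> F x) ->
  exists F' : {fset M}, forall z x, deform xi (u z) (w z) (t z) x != 0 -> x \in F'.
Proof.
move=> finF uF wF.
have min0 z x : 0 <= Num.min (clamp (t z - 1)) (w z x).
  by rewrite le_min clamp_ge0 w0.
have [C finC CP] := finite_level_tame (tame_cut ct tw) min0.
have finF' : finite_set (F `|` xi @` (set0 |` C)).
  by rewrite !finite_setU; split=> //; apply: finite_image; rewrite finite_setU.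
exists (fset_set (F `|` xi @` (set0 |` C))) => z x dx.
rewrite in_fset_set //; apply/mem_set; apply: contrapT => /not_orP[nF nxi].
move: dx; rewrite /deform.
have -> : u z x = 0 by apply: contra_notP nF => /eqP; exact: uF.
have -> : w z x = 0 by apply: contra_notP nF => /eqP; exact: wF.
rewrite sub0r (max_idPl _) ?oppr_le0 ?clamp_ge0 //.
have -> : push xi (fun y => Num.min (clamp (t z - 1)) (w z y)) x = 0.
  apply: contra_notP nxi => /eqP /push_neq0[A <- lA].
  by exists A => //; right; apply: (CP z); rewrite gt_eqF.
have -> : (x == xi set0) = false.
  by apply/negP => /eqP xe; apply: nxi; exists set0; [left|rewrite xe].
by rewrite /= ?(mulr0, addr0, mulr0n) eqxx.
Qed.

End finite_deformation.

Lemma bary_gt0_exists (R : realType) (V : choiceType) (K : set (set V))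
  (x : realization R K) : exists v, 0 < bary x v.
Proof.
apply: contrapT => H; have /eqP := bary_sum x.
suff -> : \sum_(v \in [set: V]) bary x v = 0 by rewrite eq_sym oner_eq0.
apply: fsbig1 => v _; apply/eqP; rewrite eq_le bary_ge0 andbT leNgt.
by apply/negP => xv; apply: H; exists v.
Qed.

Section sphere_maps.
Variables (R : realType) (k : nat) (V : choiceType) (K : set (set V)).
Local Notation E := 'rV[R]_k.+1.
Variable f : E -> realization R K.
Hypothesis cf : {within @unit_sphere R k.+1, continuous f}.

Lemma bary_dir_continuous (v : V) (z : E) : 0 < sqn z ->
  {for z, continuous (fun z => bary (f (dir z)) v)}.
Proof.
move=> z0; have sz : unit_sphere (dir z) by exact: sqn_dir.
have fz := (subspace_continuousP _ _).1 cf _ sz.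
move=> U /bary_continuous /= /fz /= nU.
have dU : \forall z' \near z, unit_sphere (dir z') -> U (bary (f (dir z')) v).
  exact: (dir_continuous z0 nU).
suff : \forall z' \near z, U (bary (f (dir z')) v) by [].
by apply: filterS2 dU (near_sqn_gt0 z0) => z' H /sqn_dir; exact: H.
Qed.

(** A Lebesgue number for the cover of the sup-norm sphere by the preimages of open vertex stars. *)
Lemma sphere_lebesgue : exists N : nat, forall y : E, `|y| = 1 ->
  exists v, forall y' : E, `|y'| = 1 ->
    (forall i, N%:R * `|y ord0 i - y' ord0 i| < 2) -> bary (f (dir y')) v != 0.
Proof.
have /compact_near_coveringP cC := @compact_sup_sphere R k.
pose P (N : nat) (y : E) := exists v, forall y' : E, `|y'| = 1 ->
    (forall i, N%:R * `|y ord0 i - y' ord0 i| < 2) -> bary (f (dir y')) v != 0.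
suff : \forall N \near \oo, [set y : E | `|y| = 1] `<=` P N.
  by move=> [N _ /(_ N (leqnn N)) H]; exists N.
apply: cC => y /= y1.
have y0 : 0 < sqn y by rewrite sqn_gt0 -normr_gt0 y1.
have [v v0] := bary_gt0_exists (f (dir y)).
have : \forall y' \near y, bary (f (dir y')) v != 0.
  have := @bary_dir_continuous v y y0 => /(_ [set r | r != 0]); apply.
  apply: open_nbhs_nbhs; split; first exact: open_neq.
  by rewrite /= gt_eqF.
move=> /nbhs_ballP[e /= e0 He].
have e20 : 0 < e / 2 by lra.
(* Half of [e] pays for moving [y] to [y']; the other half bounds the distance 2/N from [y'] to
   [y'']. *)
exists (ball y (e / 2), [set N : nat | 4 / e <= N%:R]).
  by split => /=; [exact: nbhsx_ballx|exact: nbhs_infty_ger].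
move=> [y' N] [/= [_ yy'] HN]; exists v => y'' y''1 Hy''; apply: He; split => // i j.
rewrite (ord1 i); have := yy' ord0 j; have := Hy'' j.
rewrite -!ball_normE /ball_ /= => h1 h2.
have h3 : `|y' ord0 j - y'' ord0 j| < e / 2.
  have : 4 / e * `|y' ord0 j - y'' ord0 j| < 2.
    by apply: le_lt_trans h1; rewrite ler_wpM2r.
  by rewrite mulrAC ltr_pdivrMr //; lra.
have -> : y ord0 j - y'' ord0 j = (y ord0 j - y' ord0 j) + (y' ord0 j - y'' ord0 j).
  by rewrite addrA subrK.
by apply: le_lt_trans (ler_normD _ _) _; lra.
Qed.

End sphere_maps.

Lemma continuous_affine (R : realType) (Z : topologicalType) (q : Z -> R) a b :
  continuous q -> continuous (fun z => a * (b - q z)).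
Proof.
move=> cq z; apply: cvgM; first exact: cvg_cst.
by apply: cvgB; [exact: cvg_cst|exact: cq].
Qed.

Lemma continuous_mulc (R : realType) (Z : topologicalType) (q : Z -> R) a z :
  {for z, continuous q} -> {for z, continuous (fun z => q z * a)}.
Proof. by move=> cq; apply: cvgM => //; exact: cvg_cst. Qed.

(** * Extending maps from the sphere over the ball *)

Section sphere_extension.
Variables (R : realType) (M : choiceType) (K : set (set M)).
Hypotheses (piK : pi_space K) (finK : forall s, K s -> finite_set s).
Variables (B : {fset M}) (k : nat).
Hypotheses (KB : K [set` B]) (kB : (k.+2 <= #|` B|)%N).
Local Notation E := 'rV[R]_k.+1.
Variable f : E -> realization R K.
Hypothesis cf : {within @unit_sphere R k.+1, continuous f}.

Let small : set (set M) := [set s | finite_set s /\ (#|` fset_set s| < #|` B|)%N].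

Lemma small_subset (s t : set M) : t `<=` s -> small s -> small t.
Proof.
move=> ts [fs ltB]; have ft := sub_finite_set ts fs; split => //.
apply: leq_ltn_trans ltB; apply: fsubset_leq_card; apply/fsubsetP => x.
by rewrite !in_fset_set // => /set_mem/ts/mem_set.
Qed.

Lemma small_selector : exists xi, selector K small xi.
Proof.
have [x0 _] := pi_ground_nonempty piK.
apply: (@selector_exists _ _ piK small (nth x0 B)) => s Ks [_].
rewrite set_fsetK => sB; exists #|` B|, B; split => // x /= xB.
by exists (index x B); rewrite /= ?index_mem // nth_index.
Qed.

(** The squared radius serves as time, running the deformation from [f] on the sphere to a constant
    near the centre. First [f] moves inside its carriers to a function [w] supported on at most
    [k.+1] vertices, fewer than [B] has, as the selector requires. *)
Lemma sphere_extension : exists2 g : E -> realization R K,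
  continuous g & forall x, unit_sphere x -> g x = f x.
Proof.
have [xi xiP] := small_selector.
have [F FP] : exists F : {fset M}, forall z, 0 < sqn z ->
    forall v, bary (f (dir z)) v != 0 -> v \in F.
  have [F FP] := compact_vertices finK (continuous_compact cf (@compact_unit_sphere R k)).
  by exists F => z z0; apply: FP; exists (dir z) => //; exact: sqn_dir.
have [N NP] := sphere_lebesgue cf.
pose grid := {ffun 'I_k.+1 -> 'I_(N + N).+1}.
(* Simplicial approximation: on the sup-norm sphere, the open star of a grid node goes into the open
   star of the chosen vertex. *)
have /choice[vtx vtxP] : forall g : grid, exists v, forall y : E,
    `|y| = 1 -> kuhn g y != 0 -> bary (f (dir y)) v != 0.
  move=> g; have [[y [y1 gy]]|H] := pselect (exists y : E, `|y| = 1 /\ kuhn g y != 0).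
    have [v vP] := NP y y1; exists v => y' y'1 gy'; apply: vP => // i.
    exact: kuhn_near gy gy'.
  have [x0 _] := pi_ground_nonempty piK.
  by exists x0 => y y1 gy; exfalso; apply: H; exists y.
(* The factor [c] vanishes near the origin, where [dir] and [hat] are not
   continuous, and equals 1 as long as [deform] depends on [u] and [w]. *)
pose c (z : E) := clamp (8 * sqn z - 1).
(* Time is 0 on the unit sphere and at least 3 for squared radius at most 1/4. Dividing by the
   number of nodes ensures [w <= 1] for [deform_support]; the total mass is normalized at the
   end. *)
pose t (z : E) := 4 * (1 - sqn z).
pose u z x := c z * bary (f (dir z)) x.
pose w z x := \sum_(g <- enum grid) (c z * (kuhn g (hat z) / #|grid|%:R)) * (vtx g == x)%:R.
have card_grid : 0 < #|grid|%:R :> R.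
  by rewrite ltr0n; apply/card_gt0P; exists [ffun=> ord0].
have c_sqn z : c z != 0 -> 0 < sqn z.
  rewrite lt_neqAle sqn_ge0 andbT eq_sym; apply: contra => /eqP z0.
  by rewrite /c z0 clamp_0 //; lra.
have c1 z : 4^-1 <= sqn z -> c z = 1 by move=> z4; apply: clamp_1; lra.
have ct : continuous t by apply: continuous_affine; exact: sqn_continuous.
have u0 z x : 0 <= u z x by rewrite mulr_ge0 ?clamp_ge0 ?bary_ge0.
have uF z x : u z x != 0 -> x \in F.
  by rewrite mulf_eq0 negb_or => /andP[/c_sqn z0]; exact: (FP z z0 x).
have w0 z x : 0 <= w z x.
  by apply: sumr_ge0 => g _; rewrite !mulr_ge0 ?clamp_ge0 ?kuhn_ge0 ?invr_ge0 // ltW.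
have w1 z x : w z x <= 1.
  apply: (@le_trans _ _ (\sum_(g <- enum grid) #|grid|%:R^-1)).
    apply: ler_sum => g _; rewrite -[leRHS]mulr1 ler_pM ?lern1 ?leq_b1 //.
      by rewrite !mulr_ge0 ?clamp_ge0 ?kuhn_ge0 ?invr_ge0 // ltW.
    rewrite -[leRHS]mul1r ler_pM ?clamp_ge0 ?clamp_le1 //.
      by rewrite divr_ge0 ?kuhn_ge0 // ltW.
    by rewrite -[leRHS]mul1r ler_wpM2r ?kuhn_le1 // invr_ge0 ltW.
  by rewrite big_enum /= sumr_const -[leLHS]mulr_natr mulVf // gt_eqF.
have w_vtx z x : w z x != 0 -> exists2 g, kuhn g (hat z) != 0 & vtx g = x /\ c z != 0.
  move=> wx; apply: contrapT => H; move/eqP: wx; apply; apply: big1_seq => g _.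
  have [vx|] := eqVneq (vtx g) x; last by rewrite mulr0.
  have [->|cz] := eqVneq (c z) 0; first by rewrite !mul0r.
  have [->|gz] := eqVneq (kuhn g (hat z)) 0; first by rewrite mul0r mulr0 mul0r.
  by exfalso; apply: H; exists g.
have wu z x : w z x != 0 -> u z x != 0.
  move=> /w_vtx[g gz [<- cz]]; rewrite mulf_neq0 //.
  have z0 := c_sqn z cz; have := vtxP g (hat z) (norm_hat z0) gz.
  by rewrite dir_hat.
have w_neq0 z : c z != 0 -> exists x, w z x != 0.
  move=> cz; have z0 := c_sqn z cz; have [hle _] := norm_coord (norm_hat z0).
  have [g gz] := @kuhn_cover R k N (hat z) hle.
  exists (vtx g); rewrite gt_eqF // /w (big_rem g) ?mem_enum //= eqxx mulr1.
  rewrite ltr_pwDl ?sumr_ge0 // => [|h _].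
    by rewrite !mulr_gt0 ?invr_gt0 // lt_neqAle eq_sym ?cz ?gz ?clamp_ge0 ?kuhn_ge0.
  by rewrite !mulr_ge0 ?clamp_ge0 ?kuhn_ge0 ?invr_ge0 // ltW.
have tu : tame u.
  split; last first.
    by move=> x; apply: cutoff_continuous => [|z z0]; [exact: sqn_continuous|exact: bary_dir_continuous].
  (* All elements outside [F] receive the index [size F], and [u] vanishes there. *)
  exists 'I_(size F).+1, (fun x => inord (index x F)) => z x y /(congr1 val).
  rewrite /= !inordK ?ltnS ?index_size // => exy.
  have [Fx|nFx] := boolP (x \in F).
    have Fy : y \in F by rewrite -index_mem -exy index_mem.
    by rewrite -(nth_index x Fx) exy nth_index.
  have nFy : y \notin F by rewrite -index_mem -exy index_mem.
  have /negP/negPn/eqP -> : ~ u z x != 0 by move/uF; exact/negP.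
  by have /negP/negPn/eqP -> : ~ u z y != 0 by move/uF; exact/negP.
have tw : tame w.
  apply: tame_sum => g; apply: cutoff_continuous => [|z z0]; first exact: sqn_continuous.
  apply: (@continuous_mulc R E (fun z => kuhn g (hat z))).
  apply: (@kuhn_continuous R k N E (@hat R k) g z) => i.
  exact: (@continuous_comp E E R (@hat R k) (fun y => y ord0 i) z (hat_continuous z0)
    (@coord_continuous R 1 k.+1 ord0 i (hat z))).
have fin_w z : finite_set [set x | w z x != 0].
  by apply: (sub_finite_set _ (finite_fset F)) => x /= /wu/uF.
(* A point of the sup-norm sphere meets at most [k.+1] stars, one fewer than the lower bound [kB] on
   the size of [B]. *)
have small_w z : 0 < sqn z -> small [set x | w z x != 0].
  move=> z0; split => //.
  have [_ [i0 hi0]] := norm_coord (norm_hat z0).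
  apply: leq_trans kB; rewrite ltnS.
  apply: leq_trans (@kuhn_card R k N (hat z) i0 hi0).
  pose S := [fset x in [seq vtx g | g <- enum [set g : grid | kuhn g (hat z) != 0]%SET]]%fset.
  apply: (@leq_trans #|` S|).
    apply: fsubset_leq_card; apply/fsubsetP => x; rewrite in_fset_set //.
    move=> /set_mem /w_vtx[g gz [<- _]]; rewrite inE /=.
    by apply: map_f; rewrite mem_enum inE.
  by rewrite card_fseq (leq_trans (size_undup _)) // size_map -cardE.
pose a z := deform xi (u z) (w z) (t z).
have aP z : (exists x, 0 < a z x) /\ K [set x | a z x != 0].
  have Kxi0 : K [set xi set0].
    have K0 : K set0 by exact: pi_subset KB.
    have small0 : small set0 by split; [|rewrite fset_set0 cardfs0; lia].
    have := xiP set0 [set set0]; rewrite set0U image_set1; apply => //.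
    by move=> s ->; split.
  (* From time 3 on only the Dirac mass at [xi set0] is left, which settles the centre of the ball,
     where [c] may vanish. *)
  have [t3|t3] := leP 3 (t z).
    rewrite /a deform_ge3 //; split; first by exists (xi set0); rewrite eqxx ltr01.
    by apply: pi_subset Kxi0 => // x /=; rewrite pnatr_eq0 eqb0 negbK => /eqP.
  have z4 : 4^-1 <= sqn z by move: t3; rewrite /t; lra.
  have z0 : 0 < sqn z by apply: lt_le_trans z4; rewrite invr_gt0.
  have Ku : K [set x | u z x != 0].
    suff -> : u z = bary (f (dir z)) by exact: bary_supp.
    by apply/funext => x; rewrite /u c1 // mul1r.
  have cz : c z != 0 by rewrite c1 // oner_neq0.
  have [[T [p pw]] _] := tw.
  split; first exact: deform_gt0 (u0 z) (w0 z) (wu z) (pw z) (w_neq0 z cz) (t z).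
  exact: deform_support (pi_subset piK) small_subset xiP (w0 z) (w1 z) (wu z)
    Ku (fin_w z) (small_w z z0) (pw z) (t z).
have [F' F'P] := @deform_finite R M E xi u w t tw w0 ct [set` F] (finite_fset F) uF
  (fun z x wx => uF z x (wu z x wx)).
have [g cg gE] := @barycenter_map R M K E a F' (fun z x => deform_ge0 xi (w z) (t z) x (u0 z))
  (fun z => (aP z).1) (fun z => (aP z).2) F'P
  (tame_deform xi tu tw w0 ct).2.
exists g => // x x1; have {}x1 : sqn x = 1 by [].
have ax : a x = bary (f x).
  rewrite /a /t x1 deform_le0 //; last by rewrite subrr mulr0.
  by apply/funext => y; rewrite /u c1 ?x1 ?mul1r ?dir_id // invf_le1 ?ler1n.
apply: realization_inj; apply/funext => v.
by rewrite gE ax bary_sum divr1.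
Qed.

End sphere_extension.

(** * Contraction in infinite rank *)

Lemma chain_min (M : Type) (s : seq (set M)) : s != [::] ->
  (forall A B, A \in s -> B \in s -> A `<=` B \/ B `<=` A) ->
  exists2 B, B \in s & forall C, C \in s -> B `<=` C.
Proof.
elim: s => // A s IHs _ ch; have [->|s0] := eqVneq s [::].
  by exists A; rewrite ?inE // => C; rewrite inE => /eqP ->.
have [||B Bs Bmin] := IHs => //.
  by move=> C D Cs Ds; apply: ch; rewrite inE ?Cs ?Ds orbT.
have [||AB|BA] := ch A B; rewrite ?inE ?eqxx ?Bs ?orbT //.
  exists A; first by rewrite inE eqxx.
  by move=> C; rewrite inE => /orP[/eqP->//|/Bmin]; exact: subset_trans.
exists B; first by rewrite inE Bs orbT.
by move=> C; rewrite inE => /orP[/eqP->//|/Bmin].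
Qed.

(** * Recovering a weighted chain from its sum of indicators *)

Section chain_levels.
Variables (R : realType) (M : choiceType) (s : {fset (set M)}) (q : set M -> R).
Hypotheses (chain_s : forall A B, A \in s -> B \in s -> A `<=` B \/ B `<=` A)
  (s_neq0 : forall A, A \in s -> A !=set0) (q0 : forall A, A \in s -> 0 < q A).

Definition chain_sum x : R := \sum_(A <- s) q A * `[< A x >]%:R.

Lemma chain_sum_ge0 x : 0 <= chain_sum x.
Proof.
rewrite /chain_sum big_seq sumr_ge0 // => A As.
by rewrite mulr_ge0 // ltW // q0.
Qed.

Lemma factors_chain_sum : exists (T : finType) (p : M -> T), factors p chain_sum.
Proof.
have [[T [p pP]] _] := @tame_sum R M R _ (s : seq (set M)) (fun=> q)
  (fun A x => `[< A x >]) (fun A => @cst_continuous _ _ _).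
by exists T, p => x y /(pP 0).
Qed.

Lemma chain_sum_le x y : (forall C, C \in s -> C x -> C y) ->
  chain_sum x <= chain_sum y.
Proof.
move=> xy; rewrite /chain_sum big_seq [leRHS]big_seq; apply: ler_sum => C Cs.
apply: ler_wpM2l; first exact/ltW/q0.
have [Cx|nCx] := pselect (C x); last by rewrite (asboolF nCx) ler0n.
by rewrite !asboolT //; exact: xy.
Qed.

Lemma chain_sum_lt x y B : (forall C, C \in s -> C x -> C y) ->
  B \in s -> B y -> ~ B x -> chain_sum x < chain_sum y.
Proof.
move=> xy Bs By nBx; rewrite /chain_sum !(big_rem B Bs) /=.
rewrite (asboolT By) (asboolF nBx) mulr0 mulr1; apply: ltr_leD; first exact: q0.
rewrite big_seq [leRHS]big_seq; apply: ler_sum => C /mem_rem Cs.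
apply: ler_wpM2l; first exact/ltW/q0.
have [Cx|nCx] := pselect (C x); last by rewrite (asboolF nCx) ler0n.
by rewrite !asboolT //; exact: xy.
Qed.

Let not_sub_chain A B x : A \in s -> B \in s -> A x -> ~ B x -> B `<=` A.
Proof. by move=> As Bs Ax nBx; have [/(_ x Ax)//|//] := chain_s As Bs. Qed.

(** A minimum point of [A] lies in just those members that contain [A], and a maximum point outside
    [A] in just those that contain [A] strictly. The two values differ by [q A]. *)
Lemma level_chain_sum_in A : A \in s -> level chain_sum A = q A.
Proof.
move=> As; have [T [p pP]] := factors_chain_sum.
have [x Ax xmin] := factors_min pP (s_neq0 As).
have xE B : B \in s -> `[< B x >] = `[< A `<=` B >].
  move=> Bs; apply/asboolP/asboolP => [Bx|]; last by apply.
  move=> x' Ax'; apply: contrapT => nBx'.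
  have := xmin x' Ax'; rewrite leNgt; apply/negP; rewrite negbK.
  apply: (@chain_sum_lt _ _ B) => // C Cs Cx'.
  exact: (not_sub_chain Cs Bs Cx' nBx').
have uxE : chain_sum x = q A + \sum_(B <- s | B != A) q B * `[< A `<=` B >]%:R.
  rewrite /chain_sum (bigD1_seq A) ?fset_uniq //= (asboolT Ax) mulr1; congr (_ + _).
  by rewrite big_seq_cond [RHS]big_seq_cond; apply: eq_bigr => B /andP[/xE ->].
rewrite /level (inf_image_min Ax xmin).
(* If [A] is everything, the right side vanishes and agrees with [sup set0 = 0]. *)
suff -> : sup (chain_sum @` (~` A)) = \sum_(B <- s | B != A) q B * `[< A `<=` B >]%:R.
  by rewrite uxE addrK (max_idPr _) // ltW // q0.
have [cA0|] := pselect ((~` A) !=set0); last first.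
  move=> /set0P/negP/negPn/eqP cA0; rewrite cA0 image_set0 sup0.
  rewrite big_seq_cond big1 // => B /andP[Bs BA].
  rewrite asboolF ?mulr0 // => AB; move/eqP: BA; apply.
  apply/seteqP; split=> // y _; apply: contrapT => nAy.
  by have : (~` A) y by []; rewrite cA0.
have [y nAy ymax] := factors_max pP cA0.
rewrite (sup_image_max nAy ymax) /chain_sum (bigD1_seq A) ?fset_uniq //=.
rewrite (asboolF nAy) mulr0 add0r big_seq_cond [RHS]big_seq_cond.
apply: eq_bigr => B /andP[Bs /eqP BA]; congr (_ * _%:R).
suff -> : `[< B y >] = `[< A `<=` B >] by [].
apply/asboolP/asboolP => [By|AB]; first exact: (not_sub_chain Bs As By nAy).
apply: contrapT => nBy.
have [y' [By' nAy']] : exists y', B y' /\ ~ A y'.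
  apply: contrapT => H; apply: BA; apply/seteqP; split => // y' By'.
  by apply: contrapT => nAy'; apply: H; exists y'.
have := ymax y' nAy'; rewrite leNgt; apply/negP; rewrite negbK.
apply: (@chain_sum_lt _ _ B) => // C Cs Cy.
exact: (not_sub_chain Cs Bs Cy nBy).
Qed.

(** A set of positive level would equal the least member of the chain containing one of its minimum
    points. *)
Lemma level_chain_sum_notin A : A \notin s -> level chain_sum A = 0.
Proof.
move=> nAs; have [T [p pP]] := factors_chain_sum.
apply/eqP; rewrite eq_le level_ge0 andbT leNgt; apply/negP.
move=> /(level_gt0 pP chain_sum_ge0)[A0 u_gt0 ltA].
have [x Ax xmin] := factors_min pP A0.
have [||B + Bmin] := @chain_min M [seq B <- s | `[< B x >]].
- apply/negP => /eqP s0; have := u_gt0 x Ax.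
  rewrite /chain_sum big1_seq ?ltxx // => B /andP[_ Bs].
  rewrite asboolF ?mulr0 // => Bx.
  have : B \in [seq B <- s | `[< B x >]] by rewrite mem_filter Bs andbT; exact/asboolP.
  by rewrite s0.
- by move=> B C; rewrite !mem_filter => /andP[_ Bs] /andP[_ Cs]; exact: chain_s.
rewrite mem_filter => /andP[/asboolP Bx Bs].
suff AB : A = B by rewrite AB Bs in nAs.
have Bmin' C : C \in s -> C x -> B `<=` C.
  by move=> Cs Cx; apply: Bmin; rewrite mem_filter Cs andbT; exact/asboolP.
apply/seteqP; split=> y.
  move=> Ay; apply: contrapT => nBy.
  have := xmin y Ay; rewrite leNgt; apply/negP; rewrite negbK.
  apply: (@chain_sum_lt _ _ B) => // C Cs Cy.
  exact: (not_sub_chain Cs Bs Cy nBy).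
move=> By; apply: contrapT => /(ltA x y Ax); rewrite ltNge; apply/negP; rewrite negbK.
by apply: chain_sum_le => C Cs Cx; exact: (Bmin' C).
Qed.

End chain_levels.

(* On a product with an interval, continuity can be tested on the closed
   simplices: by the tube lemma the points [x] with [{x} * J] sent into an open
   set form an open set of each simplex, for [J] a compact interval. *)
Lemma realization_homotopy_continuous (R : realType) (V : choiceType)
    (K : set (set V)) (Y : topologicalType) (H : realization R K * R -> Y) :
  (forall s, K s -> s !=set0 -> exists rho : {ptws V -> R} -> realization R K,
    (forall x, closed_simplex s x -> rho (bary x) = x) /\
    continuous (fun qt : {ptws V -> R} * R => H (rho qt.1, qt.2))) ->
  continuous H.
Proof.
move=> rhoP [p0 t0] U.
rewrite nbhsE => -[W [oW Wpt] /filterS]; apply.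
have [e e0 He] : exists2 e : R, 0 < e & forall t, `|t0 - t| <= e -> W (H (p0, t)).
  have s0 : [set v | bary p0 v != 0] !=set0.
    by have [v v0] := bary_gt0_exists p0; exists v; rewrite /= gt_eqF.
  have [rho [rhoE crho]] := rhoP _ (bary_supp p0) s0.
  have ct : continuous (fun t : R => H (rho (bary p0), t)).
    move=> t; apply: (@continuous_comp _ _ _ (fun t : R => (bary p0 : {ptws V -> R}, t))
      (fun qt => H (rho qt.1, qt.2))); last exact: crho.
    move=> A [[B C] /= [nB nC] BC].
    suff : \forall t' \near t, A ((bary p0 : {ptws V -> R}), t') by [].
    apply: filterS nC => t' Ct'; apply: (BC (_, t')); split => //=.
    exact: (@nbhs_singleton {ptws V -> R}).
  have rp : rho (bary p0) = p0 by exact: rhoE.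
  have : nbhs t0 [set t | W (H (p0, t))].
    have := ct t0 W; rewrite rp => cW.
    exact: (cW (open_nbhs_nbhs (conj oW Wpt))).
  move=> /nbhs_ballP[e /= e0 He]; exists (e / 2); first by lra.
  move=> t tt0; apply: (He t); rewrite -ball_normE /ball_ /=; lra.
pose J := `[t0 - e, t0 + e]%classic.
pose G := [set p | forall t, J t -> W (H (p, t))].
have oG : open G.
  rewrite realization_openE => s Ks.
  have [s0|/set0P/negP/negPn/eqP s0] := pselect (s !=set0); last first.
    exists set0; first exact: open0.
    rewrite preimage_set0 set0I; apply/seteqP; split=> // x [_ xs].
    have [v v0] := bary_gt0_exists x.
    by have := xs v; rewrite s0 /= gt_eqF // => /(_ isT).
  have [rho [rhoE crho]] := rhoP _ Ks s0.
  exists [set q | forall t, J t -> W (H (rho q, t))]; last first.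
    by apply/seteqP; split=> x [Gx xs]; split => // t /Gx; rewrite rhoE.
  rewrite openE => q Oq; rewrite /interior.
  have /compact_near_coveringP cJ : compact J by exact: segment_compact.
  have := cJ {ptws V -> R} (nbhs q) (fun q t => W (H (rho q, t))) _.
  apply => t Jt.
  have [[A B] /= [nA nB] AB] : nbhs (q, t) [set qt | W (H (rho qt.1, qt.2))].
    by apply: (crho (q, t)); apply: open_nbhs_nbhs; split => //; exact: Oq.
  exists (B, A) => // -[t' q'] [/= Bt' Aq']; exact: (AB (q', t')).
exists (G, ball t0 e).
  split => /=; last exact: nbhsx_ballx.
  apply: open_nbhs_nbhs; split => // t; rewrite /J /= in_itv /= => /andP[h1 h2].
  by apply: He; rewrite ler_norml; apply/andP; split; lra.
move=> [p t] [/= Gp Bt]; apply: Gp; move: Bt; rewrite -ball_normE /ball_ /= /J /= in_itv /=.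
by rewrite ltr_norml => /andP[h1 h2]; apply/andP; split; lra.
Qed.

Section simplex_retraction.
Variables (R : realType) (V : choiceType) (K : set (set V)) (s : {fset V}).
Hypotheses (Ksub : forall t : set V, t `<=` [set` s] -> K t) (s0 : s != fset0).

(* Clipping the coordinates at 0 and putting the missing mass on one vertex
   keeps the total at least 1. *)
Lemma simplex_retraction : exists2 rho : {ptws V -> R} -> realization R K,
  continuous rho & (forall q, closed_simplex [set` s] (rho q)) /\
    forall x, closed_simplex [set` s] x -> rho (bary x) = x.
Proof.
have [v0 v0s] : exists v0, v0 \in s by apply/fset0Pn.
pose pos (q : V -> R) v := Num.max 0 (q v).
pose a (q : V -> R) v :=
  if v \in s then pos q v + (v == v0)%:R * Num.max 0 (1 - \sum_(w <- s) pos q w) else 0.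
have pos0 q v : 0 <= pos q v by rewrite le_max lexx.
have a0 q v : 0 <= a q v.
  by rewrite /a; case: ifP => // _; rewrite addr_ge0 // mulr_ge0 // le_max lexx.
have as_ q v : a q v != 0 -> v \in s by rewrite /a; case: ifP => //; rewrite eqxx.
have apos q : exists v, 0 < a q v.
  apply: contrapT => H.
  have az v : a q v = 0.
    by apply/eqP; rewrite eq_le a0 andbT leNgt; apply/negP => av; apply: H; exists v.
  have pz v : v \in s -> pos q v = 0.
    move=> vs; have := az v; rewrite /a vs => /eqP.
    by rewrite paddr_eq0 ?mulr_ge0 ?le_max ?lexx // => /andP[/eqP].
  have := az v0; rewrite /a v0s eqxx mul1r pz // add0r big1_seq => [|v /andP[_ /pz]//].
  by rewrite subr0 (max_idPr _) // => /eqP; rewrite oner_eq0.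
have ca (Z : topologicalType) (q : Z -> V -> R) :
    (forall v, continuous (fun z => q z v)) -> forall v, continuous (fun z => a (q z) v).
  move=> cq; have cpos v : continuous (fun z => pos (q z) v).
    move=> z; apply: (@continuous_max R _ (fun=> 0) (fun z => q z v)).
      exact: cst_continuous.
    exact: cq.
  move=> v z; rewrite /a; case vs: (v \in s); last exact: cst_continuous.
  apply: cvgD; first exact: cpos.
  apply: cvgM; first exact: cvg_cst.
  apply: (@continuous_max R _ (fun=> 0) (fun z => 1 - \sum_(w <- s) pos (q z) w)).
    exact: cst_continuous.
  apply: cvgB; first exact: cvg_cst.
  by apply: cvg_big => [|w _]; [exact: add_continuous|exact: cpos].
have Ka q : K [set v | a q v != 0] by apply: Ksub => v /= /as_.
have [rho crho rhoE] := @barycenter_map R V K {ptws V -> R} a s a0 apos Ka as_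
  (@ca {ptws V -> R} id (@ptws_eval_continuous R V)).
exists rho => //; split=> [q v /=|x xs].
  by rewrite rhoE mulf_eq0 negb_or => /andP[/as_].
have aE : a (bary x) = bary x.
  have pE v : pos (bary x) v = bary x v by rewrite /pos (max_idPr _) // bary_ge0.
  have s1 : \sum_(w <- s) pos (bary x) w = 1.
    under eq_bigr do rewrite pE.
    by rewrite -(bary_sum x) (fsum_fset (F := s)).
  apply/funext => v; rewrite /a s1 subrr maxxx mulr0 addr0 pE.
  case: ifPn => // vs; apply/esym/eqP; apply: contraNT vs => xv; exact: (xs v).
by apply: realization_inj; apply/funext => v; rewrite rhoE aE bary_sum divr1.
Qed.

End simplex_retraction.

(** Exchange with a larger independent set enlarges any finite one; iterating a fixed choice of new
    element gives the sequence. *)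
Lemma independent_sequence (M : choiceType) (I : set (set M)) (piI : pi_space I) :
  (forall n, exists2 s : {fset M}, I [set` s] & (n <= #|` s|)%N) ->
  exists e : nat -> M, forall n, exists b : {fset M},
    [/\ #|` b| = n, I [set` b] & [set` b] `<=` e @` `I_n].
Proof.
move=> infI; have [x0 _] := pi_ground_nonempty piI.
have /choice[pick pickP] : forall b : {fset M}, exists x, I [set` b] ->
    x \notin b /\ I [set` (x |` b)%fset].
  move=> b; have [Ib|] := pselect (I [set` b]); last by exists x0.
  have [s Is bs] := infI #|` b|.+1.
  by have [x /andP[_ xb] Ix] := pi_exchange_fset piI Is Ib bs; exists x.
pose b n := iter n (fun b => (pick b |` b)%fset) fset0.
exists (pick \o b) => n; exists (b n).
have [I0 II0] := pi_nonempty piI.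
elim: n => [|n [cn In sn]].
  split=> [|| x]; rewrite ?cardfs0 //.
  by apply: pi_subset II0 => // x.
have [pn Ipn] := pickP _ In; split => //; first by rewrite /= cardfsU1 pn cn.
move=> x; rewrite /= !inE => /orP[/eqP ->|/sn[i /= ni <-]]; first by exists n => /=.
by exists i => //=; lia.
Qed.

(** The way back from functions on [M] to the order complex: superlevel sets form a chain of
    nonempty subsets of the support. *)
Lemma level_in_order_complex (R : realType) (M : choiceType) (I : set (set M))
    (T : finType) (p : M -> T) (v : M -> R) :
  (forall s t : set M, t `<=` s -> I s -> I t) ->
  factors p v -> (forall x, 0 <= v x) -> I [set x | v x != 0] ->
  order_complex (I `\ set0) [set A | level v A != 0].
Proof.
move=> Isub pv v0 Iv.
have gt0 A : level v A != 0 -> 0 < level v A by move=> lA; rewrite lt_neqAle eq_sym lA level_ge0.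
split; first exact: finite_level pv v0.
  move=> A /= /gt0/(level_gt0 pv v0)[A0 vA _]; split => /=; last by move=> Ae; case: A0 => x; rewrite Ae.
  by apply: Isub Iv => x /vA vx /=; rewrite gt_eqF.
by move=> A B /gt0 lA /gt0 lB; exact: level_chain pv v0 lA lB.
Qed.

(** * The flow on the order complex *)

Section contraction.
Variables (R : realType) (M : choiceType) (I : set (set M)).
Hypothesis piI : pi_space I.
Local Notation D := (order_complex (I `\ set0)).
Local Notation X := (realization R D).

Let Isub := pi_subset piI.

Variable y : set M -> M.
Hypothesis yP : forall A, A !=set0 -> A (y A).

Definition chain_function (p : X) (x : M) : R :=
  \sum_(A \in [set: set M]) bary p A * `[< A x >]%:R.

Definition chosen_function (p : X) (x : M) : R :=
  \sum_(A \in [set: set M]) bary p A * (y A == x)%:R.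

Lemma chain_functionE (p : X) (s : {fset set M}) :
  (forall A, bary p A != 0 -> A \in s) -> chain_function p = chain_sum s (bary p).
Proof.
move=> ps; apply/funext => x; apply: fsum_fset => A.
by rewrite mulf_eq0 negb_or => /andP[/ps].
Qed.

Lemma chosen_functionE (p : X) (s : {fset set M}) :
  (forall A, bary p A != 0 -> A \in s) ->
  chosen_function p = fun x => \sum_(A <- s) bary p A * (y A == x)%:R.
Proof.
move=> ps; apply/funext => x; apply: fsum_fset => A.
by rewrite mulf_eq0 negb_or => /andP[/ps].
Qed.

Section at_a_point.
Variable p : X.
Let s : {fset set M} := fset_set [set A | bary p A != 0].

Let mem_s A : (A \in s) = (bary p A != 0).
Proof.
have [fs _ _] := bary_supp p.
by rewrite in_fset_set //; apply/idP/idP => [/set_mem|/mem_set].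
Qed.

Let s_chain A B : A \in s -> B \in s -> A `<=` B \/ B `<=` A.
Proof. by rewrite !mem_s; have [_ _] := bary_supp p; exact. Qed.

Let s_neq0 A : A \in s -> A !=set0.
Proof.
rewrite mem_s; have [_ sP _] := bary_supp p => /sP[_ /= A0].
exact/set0P/eqP.
Qed.

Let s_gt0 A : A \in s -> 0 < bary p A.
Proof. by rewrite mem_s => pA; rewrite lt_neqAle eq_sym pA bary_ge0. Qed.

Let uE : chain_function p = chain_sum s (bary p).
Proof. by apply: chain_functionE => A; rewrite mem_s. Qed.

Let wE : chosen_function p = fun x => \sum_(A <- s) bary p A * (y A == x)%:R.
Proof. by apply: chosen_functionE => A; rewrite mem_s. Qed.

Lemma chain_function_ge0 x : 0 <= chain_function p x.
Proof. by apply: fsumr_ge0 => A _; rewrite mulr_ge0 // bary_ge0. Qed.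

Lemma chosen_function_ge0 x : 0 <= chosen_function p x.
Proof. by apply: fsumr_ge0 => A _; rewrite mulr_ge0 // bary_ge0. Qed.

Lemma chosen_function_le1 x : chosen_function p x <= 1.
Proof.
rewrite wE -[leRHS](bary_sum p) (fsum_fset (F := s)); last by move=> A; rewrite mem_s.
apply: ler_sum => A _; rewrite -[leRHS]mulr1.
by apply: ler_wpM2l; [exact: bary_ge0|rewrite lern1 leq_b1].
Qed.

Lemma chosen_function_neq0P x : chosen_function p x != 0 ->
  exists2 A, A \in s & y A = x.
Proof.
rewrite wE => wx; apply: contrapT => H; move/eqP: wx; apply.
apply: big1_seq => A /andP[_ As].
have [yA|] := eqVneq (y A) x; last by rewrite mulr0.
by exfalso; apply: H; exists A.
Qed.

Lemma chosen_chain_neq0 x : chosen_function p x != 0 -> chain_function p x != 0.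
Proof.
move=> /chosen_function_neq0P[A As <-]; rewrite gt_eqF // uE /chain_sum.
rewrite (big_rem A As) /= asboolT; last exact: (yP (s_neq0 As)).
rewrite mulr1 ltr_pwDl ?s_gt0 // sumr_ge0 // => B _.
by rewrite mulr_ge0 // bary_ge0.
Qed.

Lemma chosen_function_neq0 : exists x, chosen_function p x != 0.
Proof.
have [A pA] := bary_gt0_exists p.
have As : A \in s by rewrite mem_s gt_eqF.
exists (y A); rewrite gt_eqF // wE (big_rem A As) /= eqxx mulr1.
by rewrite ltr_pwDl // sumr_ge0 // => B _; rewrite mulr_ge0 // bary_ge0.
Qed.

Lemma finite_chosen_function : finite_set [set x | chosen_function p x != 0].
Proof.
apply: (@sub_finite_set _ _ (y @` [set` s])); last exact: finite_image.
by move=> x /= /chosen_function_neq0P[A As <-]; exists A.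
Qed.

Lemma independent_chain_function : I [set x | chain_function p x != 0].
Proof.
have [A pA] := bary_gt0_exists p.
have As : A \in s by rewrite mem_s gt_eqF.
(* The largest member of the chain, found through complements, contains the whole support. *)
have [||B + Bmin] := @chain_min M [seq ~` C | C <- s].
- by apply/negP => /eqP s0; have := map_f (@setC M) As; rewrite s0.
- move=> _ _ /mapP[C Cs ->] /mapP[E Es ->].
  by have [CE|EC] := s_chain Cs Es; [right|left]; exact: subsetC.
move=> /mapP[C Cs BE].
have IC : I C by move: Cs; rewrite mem_s; have [_ sP _] := bary_supp p => /sP[].
apply: Isub IC => x /= ux; apply: contrapT => nCx; move/eqP: ux; apply.
rewrite uE; apply: big1_seq => E /andP[_ Es]; rewrite asboolF ?mulr0 // => Ex.
have := Bmin (~` E); rewrite BE => /(_ (map_f _ Es)) /(_ x nCx); exact.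
Qed.

Lemma factors_chain_function :
  exists (T : finType) (q : M -> T), factors q (chain_function p).
Proof. by rewrite uE; exact: factors_chain_sum. Qed.

Lemma factors_chosen_function :
  exists (T : finType) (q : M -> T), factors q (chosen_function p).
Proof.
rewrite wE; have [[T [q qP]] _] := @tame_sum R M R _ (s : seq (set M)) (fun=> bary p)
  (fun A x => y A == x) (fun A => @cst_continuous _ _ _).
by exists T, q => x z /(qP 0).
Qed.

(** Levels return the coordinates of [p], so the flow starts at the identity. *)
Lemma level_chain_function A : level (chain_function p) A = bary p A.
Proof.
rewrite uE; have [As|] := boolP (A \in s).
  exact: level_chain_sum_in.
move=> nAs; rewrite level_chain_sum_notin //.
by move: nAs; rewrite mem_s negbK => /eqP.
Qed.

End at_a_point.

Variable xi : set M -> M.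
Hypothesis xiP : selector I setT xi.

Definition flow (p : X) (t : R) : M -> R :=
  deform xi (chain_function p) (chosen_function p) t.

Lemma factors_flow p t : exists (T : finType) (q : M -> T), factors q (flow p t).
Proof.
have tame_cst (v : M -> R) : (exists (T : finType) (q : M -> T), factors q v) ->
    tame (fun _ : R => v).
  by move=> [T [q qv]]; split; [exists T, q|move=> x; exact: cst_continuous].
have [[T [q qP]] _] := @tame_deform R M R xi _ _ id
  (tame_cst _ (factors_chain_function p)) (tame_cst _ (factors_chosen_function p))
  (fun _ => chosen_function_ge0 p) (fun t => @cvg_id _ _).
by exists T, q; exact: (qP t).
Qed.

Lemma flow_ge0 p t x : 0 <= flow p t x.
Proof. exact/deform_ge0/chain_function_ge0. Qed.

Lemma flow_gt0 p t : exists x, 0 < flow p t x.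
Proof.
have [T [q qw]] := factors_chosen_function p.
exact: deform_gt0 (chain_function_ge0 p) (chosen_function_ge0 p)
  (@chosen_chain_neq0 p) qw (chosen_function_neq0 p) t.
Qed.

Lemma flow_support p t : I [set x | flow p t x != 0].
Proof.
have [T [q qw]] := factors_chosen_function p.
exact: (@deform_support R M I setT xi T q _ _ Isub (fun _ _ _ _ => Logic.I) xiP
  (chosen_function_ge0 p) (chosen_function_le1 p) (@chosen_chain_neq0 p)
  (independent_chain_function p) (finite_chosen_function p) Logic.I qw t).
Qed.

Lemma level_flow_simplex p t : D [set A | level (flow p t) A != 0].
Proof.
have [T [q qv]] := factors_flow p t.
exact: level_in_order_complex Isub qv (flow_ge0 p t) (flow_support p t).
Qed.

Lemma level_flow_gt0 p t : exists A, 0 < level (flow p t) A.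
Proof.
have [T [q qv]] := factors_flow p t; have [x vx] := flow_gt0 p t.
exact: level_gt0_exists qv (flow_ge0 p t) vx.
Qed.

(** The levels add up to the maximum of the flow, which need not be 1 after time 0; hence the
    division. *)
Lemma flow_point : exists H : X * R -> X, forall pt A, bary (H pt) A =
  level (flow pt.1 pt.2) A / \sum_(A \in [set: set M]) level (flow pt.1 pt.2) A.
Proof.
suff /choice[H HP] : forall pt : X * R, exists x : X, forall A, bary x A =
    level (flow pt.1 pt.2) A / \sum_(A \in [set: set M]) level (flow pt.1 pt.2) A.
  by exists H.
move=> [p t] /=; have [T [q qv]] := factors_flow p t.
apply: barycenter_exists => [A|||].
- exact: level_ge0.
- exact: level_flow_gt0.
- exact: level_flow_simplex.
- exact: finite_level qv (flow_ge0 p t).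
Qed.

(** On a face [s], reached through its retraction [rho], [chain_function] and [chosen_function] are
    sums over the finite set [s]. The flow is then tame, and its levels vary continuously within
    finitely many sets. *)
Lemma flow_continuous (H : X * R -> X) :
  (forall pt A, bary (H pt) A =
    level (flow pt.1 pt.2) A / \sum_(A \in [set: set M]) level (flow pt.1 pt.2) A) ->
  continuous H.
Proof.
move=> HP; apply: realization_homotopy_continuous => s [fs sP sch] s0.
have Dsub t : t `<=` [set` fset_set s] -> D t.
  rewrite fset_setK // => ts; split; first exact: sub_finite_set fs.
    exact: subset_trans sP.
  by move=> A B /ts As /ts Bs; exact: sch.
have sf0 : fset_set s != fset0.
  by apply/eqP => /(fset_set_set0 fs) se; case: s0 => A; rewrite se.
have [rho crho [rhos rhoE]] := @simplex_retraction R _ _ _ Dsub sf0.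
rewrite fset_setK // in rhos rhoE.
exists rho; split => //.
pose Z := ({ptws set M -> R} * R)%type.
have ps (qt : Z) A : bary (rho qt.1) A != 0 -> A \in fset_set s.
  by move=> /rhos As; rewrite in_fset_set //; exact/mem_set.
have cb A : continuous (fun qt : Z => bary (rho qt.1) A).
  move=> qt; have c1 : {for qt, continuous (fun qt : Z => rho qt.1)}.
    by apply: (@continuous_comp Z {ptws set M -> R} X fst rho qt); [exact: cvg_fst|exact: crho].
  exact: (@continuous_comp Z X R (fun qt : Z => rho qt.1) (fun x => bary x A) qt c1
    (@bary_continuous R _ _ A _)).
have tu : tame (fun qt : Z => chain_function (rho qt.1)).
  have -> : (fun qt : Z => chain_function (rho qt.1)) =
      (fun qt : Z => chain_sum (fset_set s) (bary (rho qt.1))).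
    by apply/funext => qt; exact: chain_functionE (ps qt).
  exact: tame_sum.
have tw : tame (fun qt : Z => chosen_function (rho qt.1)).
  have -> : (fun qt : Z => chosen_function (rho qt.1)) =
      (fun (qt : Z) x => \sum_(A <- fset_set s) bary (rho qt.1) A * (y A == x)%:R).
    by apply/funext => qt; exact: chosen_functionE (ps qt).
  exact: tame_sum.
have tv : tame (fun qt : Z => flow (rho qt.1) qt.2).
  apply: tame_deform => // [qt|]; first exact: chosen_function_ge0.
  by move=> qt; exact: cvg_snd.
have v0 (qt : Z) x := flow_ge0 (rho qt.1) qt.2 x.
have [F finF FP] := finite_level_tame tv v0.
have inF (qt : Z) A : level (flow (rho qt.1) qt.2) A != 0 -> A \in fset_set F.
  by move=> /FP FA; rewrite in_fset_set //; exact/mem_set.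
have [G cG GE] := @barycenter_map R (set M) D Z (fun qt => level (flow (rho qt.1) qt.2))
  (fset_set F) (fun _ => level_ge0 _) (fun qt => level_flow_gt0 _ _)
  (fun qt => level_flow_simplex _ _)
  inF
  (fun A => continuous_level tv v0).
suff -> : (fun qt : Z => H (rho qt.1, qt.2)) = G by [].
by apply/funext => qt; apply: realization_inj; apply/funext => A; rewrite HP GE.
Qed.

Lemma contractible_order_complex : contractible R X.
Proof.
have [H HP] := flow_point; have cH := flow_continuous HP.
pose d (x : M) : R := (x == xi set0)%:R.
have flow3 p t : 3 <= t -> flow p t = d by move=> t3; exact: deform_ge3.
have I0 : I set0 by have [s Is] := pi_nonempty piI; apply: Isub Is.
have Id : I [set x | d x != 0].
  have /(Isub _) : I (set0 `|` xi @` [set set0]).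
    by apply: xiP => // s ->; split.
  by apply=> x; rewrite /= pnatr_eq0 eqb0 negbK => /eqP ->; right; exists set0.
have factors_d : factors (fun x => x == xi set0) d by move=> x z /= xz; rewrite /d xz.
have d0 x : 0 <= d x by exact: ler0n.
(* The end point is the vertex [[set xi set0]], written through levels to match the flow at time
   3. *)
have [x0 x0E] : exists x0 : X, forall A,
    bary x0 A = level d A / \sum_(A \in [set: set M]) level d A.
  apply: barycenter_exists => [A|||].
  - exact: level_ge0.
  - by apply: (@level_gt0_exists R M _ _ d (xi set0) factors_d d0); rewrite /d eqxx ltr01.
  - exact: level_in_order_complex Isub factors_d d0 Id.
  - exact: finite_level factors_d d0.
exists x0, (fun pt => H (pt.1, 3 * pt.2)); split.
- apply: continuous_subspaceT => -[p t].
  apply: (@continuous_comp (X * R)%type (X * R)%type X (fun pt => (pt.1, 3 * pt.2)) H);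
    last exact: cH.
  move=> A [[B C] /= [nB nC] BC]; exists (B, (fun t => 3 * t) @^-1` C).
    split=> //=; have c3 : continuous (fun t : R => 3 * t).
      by move=> t'; apply: cvgM; [exact: cvg_cst|exact: cvg_id].
    exact: (c3 t _ nC).
  by move=> [p' t'] [/= Bp Ct]; exact: (BC (p', 3 * t')).
- move=> p; apply: realization_inj; apply/funext => A.
  have fp : flow p 0 = chain_function p.
    by apply: deform_le0 => // x; exact: chosen_function_ge0.
  rewrite HP /= mulr0 fp level_chain_function.
  rewrite (_ : \sum_(B \in _) _ = 1) ?divr1 // -(bary_sum p).
  by apply: eq_fsbigr => B _; exact: level_chain_function.
- move=> p; apply: realization_inj; apply/funext => A.
  by rewrite HP /= mulr1 (flow3 p 3 (lexx _)) x0E.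
Qed.

End contraction.

(** * Links, dimension and the theorem *)

Lemma pi_connected (R : realType) (M : choiceType) (K : set (set M))
    (T : {fset M}) : pi_space K -> (forall s, K s -> finite_set s) ->
  K [set` T] -> n_connected R (realization R K) (#|` T|%:Z - 2).
Proof.
move=> piK finK KT; split=> [T1|k kT f cf].
  have [x xT] : exists x, x \in T by apply/fset0Pn; rewrite -cardfs_gt0; lia.
  have Kx : K [set v | (v == x)%:R != 0 :> R].
    by apply: (pi_subset piK _ KT) => v /=; rewrite pnatr_eq0 eqb0 negbK => /eqP ->.
  have [|||p _] := @barycenter_exists R M K (fun v => (v == x)%:R) _ _ Kx.
  - by move=> v; exact: ler0n.
  - by exists x; rewrite eqxx ltr01.
  - exact: finK.
  - by exists p.
have kB : (k.+2 <= #|` T|)%N by lia.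
have [g cg gf] := sphere_extension piK finK KT kB cf.
by exists g => //; exact: continuous_subspaceT.
Qed.

(** Exchange is applied to the unions with [s]; the element found lies outside [s], which is part of
    both. *)
Lemma pi_space_link (M : choiceType) (I : set (set M)) (s : set M) :
  pi_space I -> I s -> finite_set s -> pi_space (link I s).
Proof.
move=> piI Is fs; split; first exact: pi_ground_nonempty piI.
- by exists set0; split; rewrite ?setI0 ?setU0.
- move=> t t' t't [st0 It]; split.
    by apply/seteqP; split=> // x [sx /t't tx]; rewrite -st0.
  by apply: (pi_subset piI _ It); exact: setUS.
move=> t t' [st0 It] [st'0 It'] ft ft' lt_t't.
have cU (r : set M) : finite_set r -> s `&` r = set0 ->
    #|` fset_set (s `|` r)| = (#|` fset_set s| + #|` fset_set r|)%N.
  move=> fr sr; rewrite fset_setU // cardfsU -fset_setI // sr fset_set0 cardfs0.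
  by rewrite subn0.
have [|||x [[sx|tx] nx] Ix] := pi_exchange piI It It'.
- by rewrite finite_setU.
- by rewrite finite_setU.
- by rewrite !cU //; lia.
- by exfalso; apply: nx; left.
have nsx : ~ s x by move=> sx; apply: nx; left.
exists x; first by split=> // t'x; apply: nx; right.
split; last by rewrite setUCA.
apply/seteqP; split=> // z [sz [zx|t'z]]; first by apply: nsx; rewrite -zx.
by rewrite -st'0.
Qed.

(** Removing one element at a time gives a full flag. Containment in [s] is carried along so that
    the new top set is not yet in the chain. *)
Lemma chain_of_card (M : choiceType) (I : set (set M)) (piI : pi_space I)
    (s : {fset M}) : I [set` s] ->
  exists2 c, order_complex (I `\ set0) c & #|` fset_set c| = #|` s|.
Proof.
suff H : I [set` s] -> exists c, [/\ order_complex (I `\ set0) c,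
    #|` fset_set c| = #|` s| & forall A, c A -> A `<=` [set` s]].
  by move=> /H[c [? ? _]]; exists c.
move en : #|` s| => n; elim: n s en => [|n IHn] s en Is.
  exists set0; split; [split|by rewrite fset_set0 cardfs0|by move=> A].
  - exact: finite_set0.
  - by move=> A.
  - by move=> A A'.
have [x xs] : exists x, x \in s by apply/fset0Pn; rewrite -cardfs_gt0 en.
have ss' : [set` (s `\ x)%fset] `<=` [set` s].
  by move=> y /=; rewrite !inE => /andP[].
have [||c [[fc cI cc] ccard cs]] := IHn (s `\ x)%fset.
- by move: (cardfsD1 x s); rewrite xs en; lia.
- exact: pi_subset Is.
have nsc : ~ c [set` s] by move=> /cs/(_ x xs) /=; rewrite !inE eqxx.
exists ([set` s] |` c); split.
- split; first by rewrite finite_setU; split.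
    by move=> A [->|/cI//]; split => // s0; have : [set` s] x by []; rewrite s0.
  have cs' A : c A -> A `<=` [set` s] by move=> /cs Ax; exact: subset_trans ss'.
  move=> A A' [->|cA] [->|cA']; [by left|right|left|exact: cc]; exact: cs'.
- by rewrite fset_setU1 // cardfsU1 in_fset_set // memNset // ccard.
- by move=> A [->//|/cs Ax]; exact: subset_trans ss'.
Qed.

(** Flags turn a bound on chains into one on independent sets. Conversely members of a chain are
    told apart by their cardinality, between 1 and [n]; an infinite member would have finite subsets
    of every size. *)
Lemma finite_dimensionalP (M : choiceType) (I : set (set M)) (piI : pi_space I) :
  finite_dimensional (order_complex (I `\ set0)) <->
  exists n, forall s : {fset M}, I [set` s] -> (#|` s| <= n)%N.
Proof.
split=> [[n nP]|[n nP]]; exists n.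
  by move=> s /(chain_of_card piI)[c /nP + <-].
have finI A : I A -> finite_set A.
  move=> IA; apply: contrapT => /(@infinite_set_fset _ A n.+1)[B BA].
  by rewrite ltnNge nP //; exact: pi_subset IA.
move=> c [fc cI cc].
pose card (A : set M) := #|` fset_set A|.
have cinj : {in fset_set c &, injective card}.
  have sub_eq (A B : set M) : finite_set A -> finite_set B -> A `<=` B ->
      card A = card B -> A = B.
    move=> fA fB AB cAB; rewrite -(fset_setK fA) -(fset_setK fB).
    suff /eqP -> : fset_set A == fset_set B by [].
    rewrite eqEfcard -/(card A) -/(card B) cAB leqnn andbT.
    by rewrite -fset_set_sub //; exact/subsetP.
  move=> A B; rewrite !in_fset_set // => /set_mem cA /set_mem cB cAB.
  have [[IA _] [IB _]] := (cI A cA, cI B cB).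
  by have [AB|BA] := cc A B cA cB; [|symmetry]; apply: sub_eq => //; exact: finI.
rewrite -(size_map card) -(size_iota 1 n); apply: uniq_leq_size.
  by rewrite map_inj_in_uniq ?fset_uniq.
move=> m /mapP[A Ac ->]; move: Ac; rewrite in_fset_set // => /set_mem /cI[IA /= A0].
have fA := finI A IA; rewrite mem_iota add1n ltnS.
rewrite nP ?fset_setK // andbT cardfs_gt0.
by apply/eqP => /(fset_set_set0 fA).
Qed.

(** A largest simplex [B] fixes the dimension. By exchange any simplex [S] grows to a simplex [C] of
    that size, and the difference of [C] and [S] gives both a top simplex of the link and its
    connectivity. *)
Lemma cohen_macaulay_pi_space (R : realType) (M : choiceType) (I : set (set M))
    (n : nat) : pi_space I ->
  (forall s : {fset M}, I [set` s] -> (#|` s| <= n)%N) ->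
  simplicial_complex I /\ cohen_macaulay R I.
Proof.
move=> piI nP.
have I0 : I set0 by have [s Is] := pi_nonempty piI; exact: pi_subset Is.
have finI A : I A -> finite_set A.
  move=> IA; apply: contrapT => /(@infinite_set_fset _ A n.+1)[B BA].
  by rewrite ltnNge nP //; exact: pi_subset IA.
split; first by split=> // s t; exact: pi_subset.
have [B IB Bmax] : exists2 B : {fset M}, I [set` B] &
    forall s : {fset M}, I [set` s] -> (#|` s| <= #|` B|)%N.
  pose P m := `[< exists2 B : {fset M}, I [set` B] & #|` B| = m >].
  have exP : exists m, P m.
    by exists 0%N; apply/asboolP; exists fset0; rewrite ?cardfs0 // set_fset0.
  have Pn m : P m -> (m <= n)%N by move=> /asboolP[B /nP + <-].
  case: (ex_maxnP exP Pn) => m /asboolP[B IB <-] Bmax.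
  by exists B => // s Is; apply: Bmax; apply/asboolP; exists s.
have dimI : has_dim I (#|` B|%:Z - 1).
  split; first by exists [set` B] => //; rewrite set_fsetK; lia.
  move=> s Is; have := Bmax (fset_set s); rewrite fset_setK; last exact: finI.
  by move=> /(_ Is); lia.
exists (#|` B|%:Z - 1) => // s Is.
have fs := finI s Is; pose S := fset_set s.
have SE : [set` S] = s by exact: fset_setK.
have [||C [SC _ cC IC]] := @pi_extend _ _ piI B S IB; first by rewrite SE.
  by apply: Bmax; rewrite SE.
have cardT : #|` (C `\` S)%fset| = (#|` B| - #|` S|)%N.
  by rewrite cardfsDS // cC.
have linkT : link I s [set` (C `\` S)%fset].
  split.
    apply/seteqP; split=> // x [sx /=]; rewrite !inE => /andP[+ _].
    by rewrite in_fset_set // mem_set.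
  apply: pi_subset IC => // x [sx|/=]; last by rewrite !inE => /andP[].
  by apply: (fsubsetP SC); rewrite in_fset_set // mem_set.
have SB : (#|` S| <= #|` B|)%N by rewrite -cC fsubset_leq_card.
have finL t : link I s t -> finite_set t.
  by move=> [_ /finI]; rewrite finite_setU => -[].
split; first split.
- exists [set` (C `\` S)%fset] => //; rewrite set_fsetK cardT -/S; lia.
- move=> t Lt; have [st0 Ist] := Lt; have ft := finL t Lt.
  have := Bmax (fset_set (s `|` t)); rewrite fset_setK; last exact: finI.
  move=> /(_ Ist); rewrite fset_setU // cardfsU -fset_setI // st0 fset_set0 cardfs0.
  by rewrite -/S; lia.
have -> : #|` B|%:Z - 1 - #|` fset_set s|%:Z - 1 = #|` (C `\` S)%fset|%:Z - 2.
  by rewrite cardT -/S; lia.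
exact: pi_connected (pi_space_link piI Is fs) finL linkT.
Qed.

Theorem theorem1p1 (R : realType) (M : choiceType) (I : set (set M))
    (piI : pi_space I) :
  (finite_dimensional (order_complex (I `\ set0)) ->
     simplicial_complex I /\ cohen_macaulay R I) /\
  (~ finite_dimensional (order_complex (I `\ set0)) ->
     contractible R (realization R (order_complex (I `\ set0)))).
Proof.
split=> [/(finite_dimensionalP piI)[n nP]|infI].
  exact: cohen_macaulay_pi_space nP.
have {}infI n : exists2 s : {fset M}, I [set` s] & (n <= #|` s|)%N.
  apply: contrapT => H; apply: infI; apply/(finite_dimensionalP piI); exists n => s Is.
  by rewrite leqNgt; apply/negP => ns; apply: H; exists s => //; exact: ltnW.
have [e eP] := independent_sequence piI infI.
(* No size bound is imposed here: the sequence outgrows every finite independent set. *)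
have [|xi xiP] := @selector_exists M I piI setT e.
  by move=> s _ _; have [b [cb Ib be]] := eP #|` s|.+1; exists #|` s|.+1, b; rewrite cb.
have [x0 _] := pi_ground_nonempty piI.
have /choice[y yP] : forall A : set M, exists x, A !=set0 -> A x.
  by move=> A; have [[x Ax]|nA] := pselect (A !=set0); [exists x|exists x0].
exact: (@contractible_order_complex R M I piI y yP xi xiP).
Qed.
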